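(* Let $\mu\in(\frac12,1)$, let $p_1<p_2$ be real numbers, and let $u_0$ be a tempered distribution on $\mathbb{R}$ satisfying Condition $(C_{[p_1,p_2],\mu})$. Let $u$ be the solution of the free Schrödinger equation with initial datum $u_0$. Let $\varepsilon>0$ be such that $p_1+\varepsilon<p_2$, and for $t>0$ let $$I_t:=\big(2(p_1+\varepsilon)t,\;2p_2t\big).$$ Let $\delta\in(\frac12,1)$ and $$(\sigma_1,\dots,\sigma_9):=\left(\mu,\,1,\,1,\,2,\,\delta,\,\delta,\,\tfrac32,\,\delta,\,\delta\right),$$ so that $\max_{1\le k\le 9}\{-\sigma_k\}<-\frac12$. Then there exist constants $\tilde C_k(u_0,\varepsilon)\ge0$, $k=1,\dots,9$, depending only on $u_0$, $\varepsilon$ and $\delta$, such that for all $t>0$, $$\left|\,\|u(t,\cdot)\|_{L^2(I_t)}-\frac1{\sqrt{2\pi}}\,\|\mathcal{F}u_0\|_{L^2(p_1+\varepsilon,p_2)}\right|\le\sum_{k=1}^9\tilde C_k(u_0,\varepsilon)\,t^{-\sigma_k+\frac12}.$$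
   Context: Fourier transform: $\mathcal{F}v(p)=\int_{\mathbb{R}}v(x)e^{-ixp}\,dx$, extended to tempered distributions. Condition $(C_{[p_1,p_2],\mu})$: $\mathcal{F}u_0$ is a function vanishing on $\mathbb{R}\setminus[p_1,p_2]$, and $\mathcal{F}u_0(p)=(p-p_1)^{\mu-1}\tilde u(p)$ for $p\in(p_1,p_2)$, where $\tilde u\in\mathcal{C}^1([p_1,p_2],\mathbb{C})$, $\tilde u(p_1)\ne0$ and $\tilde u(p_2)=0$ (i.e. $\mathcal{F}u_0(p_2)=0$). The solution of $[i\partial_t+\partial_x^2]u=0$, $u(0,\cdot)=u_0$, is $u(t)=\mathcal{F}^{-1}(e^{-itp^2}\mathcal{F}u_0)$, that is, for $t>0$, $x\in\mathbb{R}$, $$u(t,x)=\frac1{2\pi}\int_{p_1}^{p_2}\mathcal{F}u_0(p)\,e^{-itp^2+ixp}\,dp .$$ *)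

(* Defs.v *)
From mathcomp Require Import all_boot all_order all_algebra.
From mathcomp Require Import all_classical all_reals all_analysis.
From mathcomp Require Import complex.

Set Implicit Arguments.
Unset Strict Implicit.
Unset Printing Implicit Defensive.

Import Order.TTheory GRing.Theory Num.Theory.
Import numFieldNormedType.Exports.

Local Open Scope classical_set_scope.
Local Open Scope ring_scope.
Local Open Scope complex_scope.

Section ComplexValued.
Context {R : realType}.

(* The modulus as an element of R (`|z| has type R[i]). *)
Definition cabs (z : R[i]) : R := ComplexField.Normc.normc z.

Definition expi (theta : R) : R[i] := cos theta +i* sin theta.

(* [\int_D g], computed componentwise; meaningful when [cintegrable D g]. *)
Definition cintegral (D : set R) (g : R -> R[i]) : R[i] :=
  Rintegral lebesgue_measure D (fun x => complex.Re (g x))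
  +i* Rintegral lebesgue_measure D (fun x => complex.Im (g x)).

Definition cintegrable (D : set R) (g : R -> R[i]) : Prop :=
  lebesgue_measure.-integrable D (fun x => (complex.Re (g x))%:E) /\
  lebesgue_measure.-integrable D (fun x => (complex.Im (g x))%:E).

(* The norm of g in L^2(a, b), with value +oo when g is not square integrable. *)
Definition L2norm (a b : R) (g : R -> R[i]) : \bar R :=
  Lnorm lebesgue_measure 2%:E ((fun x => (cabs (g x))%:E) \_ `]a, b[).

(* g is C^1 up to the boundary: its derivative in the open interval extends
   continuously to the closed one. *)
Definition C1_cc (a b : R) (g : R -> R) : Prop :=
  [/\ {within `[a, b], continuous g},
      forall x, x \in `]a, b[ -> derivable g x 1 &
      exists2 g' : R -> R, {within `[a, b], continuous g'} &
        forall x, x \in `]a, b[ -> g^`()%classic x = g' x].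

Definition cC1_cc (a b : R) (g : R -> R[i]) : Prop :=
  C1_cc a b (fun x => complex.Re (g x)) /\
  C1_cc a b (fun x => complex.Im (g x)).

End ComplexValued.

Section TemperedDistributions.
Context {R : realType}.

Definition cderiven (n : nat) (phi : R -> R[i]) (x : R) : R[i] :=
  derive1n n (fun y => complex.Re (phi y)) x
  +i* derive1n n (fun y => complex.Im (phi y)) x.

Definition csmooth (phi : R -> R[i]) : Prop :=
  forall (n : nat) (x : R),
    derivable (derive1n n (fun y => complex.Re (phi y))) x 1 /\
    derivable (derive1n n (fun y => complex.Im (phi y))) x 1.

Definition is_schwartz (phi : R -> R[i]) : Prop :=
  csmooth phi /\
  forall k n : nat, exists M : R,
    forall x : R, `|x| ^+ k * cabs (cderiven n phi x) <= M.

Definition schwartz_seminorm (k n : nat) (phi : R -> R[i]) : R :=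
  sup (range (fun x : R => `|x| ^+ k * cabs (cderiven n phi x))).

(* A distribution is a functional on all functions R -> R[i] of which only the
   values on Schwartz functions are relevant; all conditions below are
   restricted to these. *)
Definition is_tempered (T : (R -> R[i]) -> R[i]) : Prop :=
  (forall (a : R[i]) (phi psi : R -> R[i]),
      is_schwartz phi -> is_schwartz psi ->
      T (fun x => a * phi x + psi x) = a * T phi + T psi) /\
  (exists (N : nat) (K : R), forall phi : R -> R[i], is_schwartz phi ->
      cabs (T phi) <=
      K * \sum_(k < N.+1) \sum_(n < N.+1) schwartz_seminorm k n phi).

Definition fourier (phi : R -> R[i]) (p : R) : R[i] :=
  cintegral setT (fun x => phi x * expi (- (x * p))).

(* Extension to tempered distributions by duality. *)
Definition fourier_distr (T : (R -> R[i]) -> R[i]) : (R -> R[i]) -> R[i] :=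
  fun phi => T (fourier phi).

(* The distribution T is (represented by) the function f. *)
Definition is_function (T : (R -> R[i]) -> R[i]) (f : R -> R[i]) : Prop :=
  forall phi : R -> R[i], is_schwartz phi ->
    cintegrable setT (fun p => f p * phi p) /\
    T phi = cintegral setT (fun p => f p * phi p).

End TemperedDistributions.

Section FreeSchroedinger.
Context {R : realType}.

(* Condition (C_{[p1,p2],mu}) for the distribution u0, where Fu0 is the
   function that represents the Fourier transform of u0.  As an element of
   L^1_loc, Fu0 is determined by u0. *)
Definition condition_C (p1 p2 mu : R) (u0 : (R -> R[i]) -> R[i])
    (Fu0 : R -> R[i]) : Prop :=
  [/\ is_function (fourier_distr u0) Fu0,
      forall p, p \notin `[p1, p2] -> Fu0 p = 0 &
      exists util : R -> R[i],
        [/\ cC1_cc p1 p2 util, util p1 != 0, util p2 = 0 &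
            forall p, p \in `]p1, p2[ ->
              Fu0 p = ((p - p1) `^ (mu - 1))%:C * util p]].

(* u(t) = F^-1 (exp(-i t p^2) F u0), for F u0 a function supported in
   [p1, p2]. *)
Definition free_solution (p1 p2 : R) (Fu0 : R -> R[i]) (t x : R) : R[i] :=
  ((2 * pi)^-1)%:C *
  cintegral `[p1, p2] (fun p => Fu0 p * expi (- (t * p ^+ 2) + x * p)).

(* (sigma_1, ..., sigma_9), indexed from 0. *)
Definition sigma (mu delta : R) (k : 'I_9) : R :=
  nth 0 [:: mu; 1; 1; 2; delta; delta; 3 / 2; delta; delta] k.

End FreeSchroedinger.

(* Main.v *)
Require Import Defs.
From mathcomp Require Import all_boot all_order all_algebra.
From mathcomp Require Import all_classical all_reals all_analysis.
From mathcomp Require Import complex.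
From mathcomp Require Import measurable_realfun.
From mathcomp Require Import ring lra.
Set Implicit Arguments.
Unset Strict Implicit.
Unset Printing Implicit Defensive.
Import Order.TTheory GRing.Theory Num.Theory.
Import numFieldNormedType.Exports.
Local Open Scope classical_set_scope.
Local Open Scope ring_scope.

(* Put x = 2 q t. Up to a phase, 2 pi u(t, x) is the integral of
   Fu0(p) exp(-i t (p - q)^2), whose stationary point q lies in ]p1 + eps, p2[.
   After replacing Fu0(p) by Fu0(p) - Fu0(q), the amplitude vanishes at q, and
   integration by parts outside neighbourhoods of size 1 / t of p1 and of q
   bounds the integral by t^-mu + t^-delta, uniformly in q (the contribution
   log t / t of q is absorbed in t^-delta). What remains is Fu0(q) times a
   Fresnel integral of modulus
   sqrt (pi / t) + O ((1 / (q - p1) + 1 / (p2 - q)) / t), where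
   Fu0(p2) = 0 compensates the factor 1 / (p2 - q). For t < 1 the pointwise
   bound is trivial, as delta > 1/2. Taking L^2 norms over I_t, an interval of
   length proportional to t, gives the theorem, with nonzero constants only for
   sigma_1 = mu and sigma_5 = delta. *)

(** * Mean value bounds and integration by parts *)

Section IncrementBounds.
Context {R : realType}.
Implicit Types (a b c q t x y : R) (f g h H : R -> R).

(** Integrals are estimated through primitives: an oscillatory integral is the increment of some [H]
    with known derivative, and [increment_le] compares it with the increment of an explicit
    majorant. Cutting an interval, subtracting [f q] and integrating by parts thus become identities
    between functions, although the amplitude is unbounded at p1. Complex exponentials are replaced
    by cosines with a free phase [c]: shifting [c] by pi / 2 turns a cosine into a sine up to sign,
    so each real estimate serves for real and imaginary parts alike. The modulus sqrt pi is found
    without improper integrals or contours: the square of the Fresnel integral from 0 to x is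
    compared with an integral over [0, 1] by differentiating in x, which also yields the rate 1 / x.
    The number pi enters through arctan 1 = pi / 4. The given eps is halved: the point p1 + eps / 2
    keeps a distance of at least eps / 2 from p1 and from every q, so the two critical points are
    handled apart, with constants independent of q. *)

Lemma increment_le f f' g g' a b : a <= b ->
  {within `[a, b], continuous f} -> {within `[a, b], continuous g} ->
  (forall x, x \in `]a, b[ -> is_derive x 1 f (f' x)) ->
  (forall x, x \in `]a, b[ -> is_derive x 1 g (g' x)) ->
  (forall x, x \in `]a, b[ -> `|f' x| <= g' x) ->
  `|f b - f a| <= g b - g a.
Proof.
move=> ab cf cg df dg fg.
have M (k k' : R -> R) : {within `[a, b], continuous k} ->
    (forall x, x \in `]a, b[ -> is_derive x 1 k (k' x)) ->
    (forall x, x \in `]a, b[ -> 0 <= k' x) -> k a <= k b.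
  move: ab; rewrite le_eqVlt => /predU1P[-> //|ab] ck dk k0.
  have [z zab e] := MVT ab dk ck.
  by rewrite -subr_ge0 e mulr_ge0 ?k0 ?subr_ge0 ?ltW.
(* The claim amounts to the monotonicity of [g - f] and of [g + f]. *)
have := M (g - f) (g' - f') _ _ _.
have := M (g + f) (g' + f') _ _ _.
rewrite !fctE => h1 h2.
rewrite ler_norml; apply/andP; split.
  suff: g a + f a <= g b + f b by lra.
  apply: h1 => [x|x xab|x xab]; first by apply: cvgD; [exact: cg|exact: cf].
    by apply: is_deriveD; [exact: dg|exact: df].
  by have := fg x xab; rewrite ler_norml => /andP[]; lra.
suff: g a - f a <= g b - f b by lra.
apply: h2 => [x|x xab|x xab]; first by apply: cvgB; [exact: cg|exact: cf].
  by apply: is_deriveB; [exact: dg|exact: df].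
by have := fg x xab; rewrite ler_norml => /andP[]; lra.
Qed.

Lemma is_derive_within_continuous f f' a b :
  (forall x, x \in `[a, b] -> is_derive x 1 f (f' x)) ->
  {within `[a, b], continuous f}.
Proof.
by move=> df; apply: derivable_within_continuous => x /df; case.
Qed.

Lemma is_derive_subr_inv q x : x - q != 0 ->
  is_derive x 1 (fun p => (p - q)^-1) (- (x - q) ^- 2).
Proof.
move=> xq; have d1 : is_derive x 1 (fun p => p - q) 1.
  by apply: is_derive_eq; rewrite subr0.
have := @is_deriveV R (fun p => p - q) x 1 1 xq d1.
by rewrite /GRing.scale /= mulr1.
Qed.

Lemma is_derive_cos_phase t c q x :
  is_derive x 1 (fun p => cos (t * (p - q) ^+ 2 + c))
    (- (2 * t * (x - q) * sin (t * (x - q) ^+ 2 + c))).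
Proof. by apply: is_derive_eq; rewrite /= /GRing.scale /=; ring. Qed.

Lemma is_derive_sin_phase t c q x :
  is_derive x 1 (fun p => sin (t * (p - q) ^+ 2 + c))
    (2 * t * (x - q) * cos (t * (x - q) ^+ 2 + c)).
Proof. by apply: is_derive_eq; rewrite /= /GRing.scale /=; ring. Qed.

(* Integration by parts: away from the stationary point q, the integrand is
   the derivative of [h / (2 t (p - q)) * sin] up to a smaller error. *)
Lemma oscillatory_increment_le H h h' g g' t c q a b :
  0 < t -> a <= b -> q \notin `[a, b] ->
  {within `[a, b], continuous H} -> {within `[a, b], continuous g} ->
  (forall x, x \in `]a, b[ ->
     is_derive x 1 H (h x * cos (t * (x - q) ^+ 2 + c))) ->
  (forall x, x \in `[a, b] -> is_derive x 1 h (h' x)) ->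
  (forall x, x \in `]a, b[ -> is_derive x 1 g (g' x)) ->
  (forall x, x \in `]a, b[ ->
     `|h' x| / `|x - q| + `|h x| / `|x - q| ^+ 2 <= g' x) ->
  `|H b - H a| <=
    (`|h a| / `|a - q| + `|h b| / `|b - q| + (g b - g a)) / (2 * t).
Proof.
move=> t0 ab qab cH cg dH dh dg hg.
have xq x : x \in `[a, b] -> x - q != 0.
  by move=> xab; rewrite subr_eq0; apply: contraNneq qab => <-.
have oc x : x \in `]a, b[ -> x \in `[a, b] by exact: subset_itv_oo_cc.
pose D x := h x / (x - q) * (sin (t * (x - q) ^+ 2 + c) / (2 * t)).
pose D' x := h x * cos (t * (x - q) ^+ 2 + c) +
  (h' x / (x - q) - h x / (x - q) ^+ 2) *
  (sin (t * (x - q) ^+ 2 + c) / (2 * t)).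
have dD x : x \in `[a, b] -> is_derive x 1 D (D' x).
  move=> xab; have := dh x xab; have := is_derive_sin_phase t c q x.
  move=> /= d1 d2.
  have ? := is_derive_subr_inv (xq _ xab).
  apply: is_derive_eq; rewrite /D' /GRing.scale /=.
  by field; rewrite (xq _ xab) (gt_eqF t0).
have sinb x : `|sin (t * (x - q) ^+ 2 + c)| <= 1.
  by rewrite ler_norml sin_geN1 sin_le1.
have Db x : x \in `[a, b] -> `|D x| <= `|h x| / `|x - q| / (2 * t).
  move=> xab; rewrite /D 3!normrM !normfV (@gtr0_norm _ (2 * t)) ?mulr_gt0//.
  rewrite mulrA ler_pM2r ?invr_gt0 ?mulr_gt0//.
  by rewrite -[leRHS]mulr1 ler_wpM2l// mulr_ge0.
pose F x := H x - D x.
pose F' x := h x * cos (t * (x - q) ^+ 2 + c) - D' x.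
pose G x := g x * (2 * t)^-1.
have cF : {within `[a, b], continuous F}.
  by move=> x; apply: cvgB; [exact: cH|exact: (is_derive_within_continuous dD)].
have cG : {within `[a, b], continuous G}.
  by move=> x; apply: cvgMl; exact: cg.
have dF x : x \in `]a, b[ -> is_derive x 1 F (F' x).
  by move=> xab; apply: is_deriveB; [exact: dH|exact/dD/oc].
have dG x : x \in `]a, b[ -> is_derive x 1 G (g' x * (2 * t)^-1).
  move=> xab; have := dg x xab => ?.
  by apply: is_derive_eq; rewrite /GRing.scale/=; ring.
have F'G x : x \in `]a, b[ -> `|F' x| <= g' x * (2 * t)^-1.
  move=> xab; rewrite /F' /D' opprD addrA subrr add0r normrN normrM normrM normfV.
  rewrite (@gtr0_norm _ (2 * t)) ?mulr_gt0//.
  rewrite mulrA ler_pM2r ?invr_gt0 ?mulr_gt0//.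
  apply: le_trans (hg x xab).
  apply: (@le_trans _ _ (`|h' x / (x - q) - h x / (x - q) ^+ 2|)).
    by rewrite -[leRHS]mulr1 ler_wpM2l.
  rewrite (le_trans (ler_normB _ _))// !normrM !normfV normrX.
  by [].
have K := increment_le ab cF cG dF dG F'G.
have aab : a \in `[a, b] by rewrite in_itv /= lexx.
have bab : b \in `[a, b] by rewrite in_itv /= lexx andbT.
have -> : H b - H a = (F b - F a) + D b - D a by rewrite /F; ring.
apply: le_trans (ler_normB _ _) _.
apply: le_trans (lerD (ler_normD _ _) (lexx _)) _.
move: (Db _ aab) (Db _ bab) K; rewrite /G.
rewrite mulrDl mulrDl (mulrBl _ (g b)).
lra.
Qed.

End IncrementBounds.

(** * Existence of primitives *)

Section Primitives.
Context {R : realType}.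
Notation mu := (@lebesgue_measure R).
Implicit Types (a b x y z : R) (f h H : R -> R).

(** Integrability on the closed interval makes the primitive continuous up to the endpoints even
    where [h] blows up; this is how singular amplitudes reach [increment_le]. *)
Lemma integrable_exists_primitive h a b : a < b ->
  mu.-integrable `[a, b] (EFin \o h) ->
  (forall x, x \in `]a, b[ -> {for x, continuous h}) ->
  exists H, [/\ {within `[a, b], continuous H},
    forall x, x \in `]a, b[ -> is_derive x 1 H (h x) &
    Rintegral mu `[a, b] h = H b - H a].
Proof.
move=> ab ih ch; exists (fun x => Rintegral mu `[a, x] h); split.
- by apply: parameterized_integral_continuous => //; exact: ltW.
- move=> x; rewrite in_itv/= => /andP[ax xb].
  have xab : x \in `]a, b[ by rewrite in_itv/= ax.
  have [d e] := @continuous_FTC1_closed _ h a x b xb ih ax (ch x xab).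
  by apply: DeriveDef => //; rewrite -derive1E.
- by rewrite set_itv1 Rintegral_set1 subr0.
Qed.

(** Primitives normalized to vanish at 0 agree on common intervals, hence glue along an exhaustion
    of the line. *)
Lemma continuous_exists_primitive h : continuous h ->
  exists H, forall x : R, is_derive x 1 H (h x).
Proof.
move=> ch.
have P (n : nat) : exists H : R -> R, [/\ {within `[- n.+1%:R, n.+1%:R], continuous H},
    forall x : R, x \in `]- n.+1%:R, n.+1%:R[ -> is_derive x 1 H (h x) & H 0 = 0].
  have [||x _|H [cH dH _]] :=
      @integrable_exists_primitive h (- n.+1%:R) n.+1%:R.
  - by rewrite gtrN// ltr0n.
  - apply: continuous_compact_integrable; first exact: segment_compact.
    by apply: continuous_subspaceT; exact: ch.
  - exact: ch.
  exists (fun x => H x - H 0); split; last by rewrite subrr.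
    by move=> x; apply: cvgB; [exact: cH|exact: cvg_cst].
  by move=> x /dH ?; apply: is_derive_eq; rewrite subr0.
have [H {}P] := choice P.
have Hmono n m x : (n <= m)%N -> x \in `]- n.+1%:R, n.+1%:R[ -> H n x = H m x.
  move=> nm xn.
  have [cn dn n0] := P n; have [cm dm m0] := P m.
  have sub : `]- n.+1%:R, n.+1%:R[ `<=` (`]- m.+1%:R, m.+1%:R[ : set R).
    by apply: subset_itvW; rewrite ?lerN2 ler_nat ltnS.
  pose D x := H n x - H m x.
  have dD y : y \in `]- n.+1%:R, n.+1%:R[ -> is_derive y 1 D 0.
    move=> yn; have := dn y yn; have := dm y (sub _ yn) => ? ?.
    by apply: is_derive_eq; rewrite subrr.
  have on : (0 : R) \in `]- n.+1%:R, n.+1%:R[.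
    by rewrite in_itv/= oppr_lt0 ltr0n.
  have D0 y z : y <= z -> y \in `]- n.+1%:R, n.+1%:R[ ->
      z \in `]- n.+1%:R, n.+1%:R[ -> D z - D y = 0.
    move=> yz yn zn.
    have sub2 w : w \in `[y, z] -> w \in `]- n.+1%:R, n.+1%:R[.
      move: yn zn; rewrite !in_itv/= => /andP[yn _] /andP[_ zn] /andP[yw wz].
      by rewrite (lt_le_trans yn yw) (le_lt_trans wz zn).
    have cD : {within `[y, z], continuous D}.
      have dyz w : w \in `[y, z] -> is_derive w 1 D 0 by move/sub2/dD.
      exact: (is_derive_within_continuous dyz).
    have dyz w : w \in `]y, z[ -> is_derive w 1 D ((fun=> 0) w).
      by move/subset_itv_oo_cc/sub2/dD.
    by have [w _ ->] := MVT_segment yz dyz cD; rewrite mul0r.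
  apply/eqP; rewrite -subr_eq0; apply/eqP; rewrite -/(D x).
  have z0 : D 0 = 0 by rewrite /D n0 m0 subrr.
  have [x0|/ltW x0] := leP 0 x; have := D0 _ _ x0; rewrite z0.
    by rewrite subr0 => ->.
  by rewrite sub0r => /(_ xn on)/eqP; rewrite oppr_eq0 => /eqP.
(* The interval of index [N x] contains x. For y near x, [H (N y) y] equals [H (N x) y], so the
   glued function inherits the derivative of the single function [H (N x)]. *)
pose N (x : R) := Num.bound `|x|.
have Nb (x : R) : x \in `]- (N x).+1%:R, (N x).+1%:R[.
  rewrite in_itv/= -ltr_norml (lt_le_trans (archi_boundP (normr_ge0 x)))//.
  by rewrite ler_nat ltnW.
exists (fun x => H (N x) x) => x.
have [_ d _] := P (N x).
have {}d := d x (Nb x).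
have E : {near x, H (N x) =1 (fun y => H (N y) y)}.
  have := near_in_itvoo (Nb x).
  apply: filterS => y yx.
  have [le|/ltnW le] := leqP (N x) (N y); first exact: Hmono.
  by rewrite (Hmono _ (N x) y).
exact: (near_eq_is_derive E).
Qed.

End Primitives.

(** * Integrability of power singularities *)

Section PowerSingularity.
Context {R : realType}.
Notation mu := (@lebesgue_measure R).
Implicit Types (a b c x nu K : R) (h : R -> R).

Lemma is_derive_powR_subr a nu x : a < x ->
  is_derive x 1 (fun p => (p - a) `^ nu) (nu * (x - a) `^ (nu - 1)).
Proof.
move=> ax; have x0 : 0 < x - a by rewrite subr_gt0.
have d1 : is_derive x 1 (fun p => p - a) 1.
  by apply: is_derive_eq; rewrite subr0.
have := @is_derive1_comp R (fun y => y `^ nu) (fun p => p - a) x _ _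
  (@is_derive1_powR R nu _ x0) d1.
by rewrite mulr1.
Qed.

Lemma continuous_powR_subr a nu x : a < x ->
  {for x, continuous (fun p => (p - a) `^ nu)}.
Proof.
move=> ax; apply: differentiable_continuous; apply/derivable1_diffP.
by have [] := is_derive_powR_subr nu ax.
Qed.

Lemma continuous_powR_subr0 a nu b : 0 < nu ->
  {within `[a, b], continuous (fun p => (p - a) `^ nu)}.
Proof.
move=> nu0; have [ba|ab] := leP b a.
  have [->|ne] := eqVneq a b.
    by rewrite set_itv1; exact: continuous_subspace1.
  rewrite set_itv_ge ?bnd_simp -?ltNge ?lt_neqAle 1?eq_sym ?ne//.
  exact: continuous_subspace0.
apply/continuous_within_itvP => //; split.
- by move=> x; rewrite in_itv/= => /andP[ax _]; exact: continuous_powR_subr.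
- rewrite subrr powR0 ?gt_eqF//.
  apply/cvgrPdist_lt => e e0.
  have /cvgrPdist_lt/(_ e e0)[d /= d0 hd] := @powR_cvg0 R nu nu0.
  exists d => //= x xd ax; apply: hd; last by rewrite /= subr_gt0.
  by rewrite /= sub0r opprB.
- by apply: cvg_at_left_filter; exact: continuous_powR_subr.
Qed.

(** Monotone convergence: on intervals that stay away from [a], the integral is an increment of (x -
    a)^nu / nu, bounded independently of the truncation. *)
Lemma integrable_powR_subr a b nu : 0 < nu -> a < b ->
  mu.-integrable `]a, b] (EFin \o (fun x => (x - a) `^ (nu - 1))).
Proof.
move=> nu0 ab; set h := fun x => (x - a) `^ (nu - 1).
have mh : measurable_fun setT h.
  apply: (@measurableT_comp _ _ _ _ _ _ (fun y : R => y `^ (nu - 1))).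
    exact: measurable_powR.
  by apply: measurable_funB.
have mh' (D : set R) : measurable_fun D h by exact: measurable_funTS.
have h0 x : 0 <= h x by exact: powR_ge0.
apply/integrableP; split; first by apply/measurable_EFinP; exact: mh'.
rewrite (_ : (fun x => _) = EFin \o h); last first.
  by apply/funext => x; rewrite gee0_abs// lee_fin.
apply: (@le_lt_trans _ _ ((b - a) `^ nu / nu)%:E); last by rewrite ltry.
rewrite itv_open_bnd_bigcup.
pose F (n : nat) : set (measurableTypeR R) := `[a + n.+1%:R^-1, b]%classic.
have cv : (\int[mu]_(x in F n) (EFin \o h) x)%E @[n --> \oo] -->
    (\int[mu]_(x in \bigcup_n F n) (EFin \o h) x)%E.
  apply: ge0_nondecreasing_set_cvg_integral.
  - move=> n m nm; rewrite subsetEset; apply: subset_itvr.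
    by rewrite bnd_simp lerD2l lef_pV2 ?posrE ?ltr0n// ler_nat ltnS.
  - by move=> n; exact: measurable_itv.
  - by move=> n; apply/measurable_EFinP; exact: mh'.
  - by move=> n x _; rewrite /= lee_fin h0.
rewrite -(cvg_lim _ cv)//; apply: lime_le; first by apply/cvg_ex; eexists; exact: cv.
apply: nearW => n; rewrite /F; set c := a + _.
have ac : a < c by rewrite ltrDl invr_gt0 ltr0n.
pose P x := (x - a) `^ nu * nu^-1.
have P0 x : 0 <= P x by rewrite mulr_ge0 ?powR_ge0// invr_ge0 ltW.
(* For small n the truncated interval may be a point or empty. *)
have [cb|] := ltP c b; last first.
  rewrite le_eqVlt => /predU1P[->|bc].
    by rewrite set_itv1 integral_set1 lee_fin P0.
  by rewrite set_itv_ge ?bnd_simp -?ltNge// integral_set0 lee_fin P0.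
have ch x : c <= x -> {for x, continuous h}.
  by move=> cx; apply: continuous_powR_subr; exact: lt_le_trans cx.
have ih : mu.-integrable `[c, b] (EFin \o h).
  apply: continuous_compact_integrable; first exact: segment_compact.
  by apply: continuous_in_subspaceT => x /set_mem/=; rewrite in_itv/= => /andP[/ch].
have [x|H [cH dH e]] := integrable_exists_primitive cb ih.
  by rewrite in_itv/= => /andP[/ltW/ch].
have dP x : x \in `[c, b] -> is_derive x 1 P (h x).
  rewrite in_itv/= => /andP[cx _].
  have ? := is_derive_powR_subr nu (lt_le_trans ac cx).
  by apply: is_derive_eq; rewrite /h /GRing.scale/=; field; rewrite gt_eqF.
have cP := is_derive_within_continuous dP.
have dP' x : x \in `]c, b[ -> is_derive x 1 P (h x).
  by move/subset_itv_oo_cc; exact: dP.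
have hh x : x \in `]c, b[ -> `|h x| <= h x by rewrite ger0_norm.
rewrite -[leLHS]fineK ?integrable_fin_num// lee_fin.
rewrite [leLHS]e (le_trans (ler_norm _))//.
rewrite (le_trans (increment_le (ltW cb) cH cP dH dP' hh))//.
by rewrite lerBlDr lerDl P0.
Qed.

(** The endpoints form a null set, so the domination and the continuity are asked only inside, where
    a singular amplitude is controlled. *)
Lemma integrable_powR_bounded h a b nu K : 0 < nu -> a < b ->
  (forall x, x \in `]a, b[ -> {for x, continuous h}) ->
  (forall x, x \in `]a, b[ -> `|h x| <= K * (x - a) `^ (nu - 1)) ->
  mu.-integrable `[a, b] (EFin \o h).
Proof.
move=> nu0 ab ch hK.
have mh : measurable_fun `]a, b[ (EFin \o h).
  apply/measurable_EFinP; apply: open_continuous_measurable_fun => //.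
  by move=> x /set_mem; exact: ch.
have ih : mu.-integrable `]a, b[ (EFin \o h).
  apply: (@le_integrable _ (measurableTypeR R) R mu `]a, b[%classic
    (measurable_itv _) (EFin \o h)
    (fun x => (K%:E * ((x - a) `^ (nu - 1))%:E)%E) mh).
    by move=> x /hK hx /=; rewrite lee_fin (le_trans hx)// ler_norm.
  apply: integrableZl => //.
  apply: integrableS (integrable_powR_subr nu0 ab) => //.
  by apply: subset_itvl; rewrite bnd_simp.
have mh2 : measurable_fun `[a, b] (EFin \o h) by exact: emeasurable_fun_itv_cc mh.
apply/integrableP; split => //.
have ma : measurable_fun `[a, b] (fun x => `|(EFin \o h) x|)%E.
  exact: measurableT_comp.
rewrite -integral_itv_bndo_bndc; last first.
  by apply: measurable_funS ma => //; apply: subset_itvl; rewrite bnd_simp.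
rewrite -integral_itv_obnd_cbnd; last first.
  by apply: measurable_funS ma => //; exact: subset_itv_oo_cc.
by move/integrableP : ih => [].
Qed.

End PowerSingularity.

(** * Phase estimates near a singular endpoint *)

Section StationaryPhase.
Context {R : realType}.
Implicit Types (a b c e q t x y r nu delta K L : R) (f h H : R -> R).

Lemma mulr_powRB1_gt0 x r : 0 < x -> x * x `^ (r - 1) = x `^ r.
Proof.
move=> x0; rewrite -{1}(powRr1 (ltW x0)) -powRD; first by rewrite addrC subrK.
by rewrite (gt_eqF x0) implybT.
Qed.

Lemma ler_powR_npos x y r : 0 < x -> x <= y -> r <= 0 -> y `^ r <= x `^ r.
Proof.
move=> x0 xy r0; rewrite -[r]opprK !(powRN _ (- r)).
rewrite lef_pV2 ?posrE ?powR_gt0 ?(lt_le_trans x0)//.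
by rewrite ge0_ler_powR ?oppr_ge0// nnegrE ltW ?(lt_le_trans x0).
Qed.

Lemma powR_div x t r : 0 < x -> 0 < t -> (x / t) `^ r = x `^ r * t `^ (- r).
Proof.
move=> x0 t0; rewrite powRM ?invr_ge0 ?ltW//.
by rewrite -powR_inv1 ?ltW// -powRrM mulN1r.
Qed.

(* Over [a, b], the contribution of the points at distance at most [e / t]
   from the singularity a is bounded directly, the rest by parts. *)
Lemma endpoint_phase_le nu K e a b q t c h h' H :
  0 < nu < 1 -> 0 < e -> 0 <= K -> 1 <= t -> b = a + e -> b + e <= q ->
  {within `[a, b], continuous H} ->
  (forall x, x \in `]a, b[ ->
     is_derive x 1 H (h x * cos (t * (x - q) ^+ 2 + c))) ->
  (forall x, x \in `]a, b] -> is_derive x 1 h (h' x)) ->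
  (forall x, x \in `]a, b] -> `|h x| <= K * (x - a) `^ (nu - 1)) ->
  (forall x, x \in `]a, b] -> `|h' x| <= K * (x - a) `^ (nu - 2)) ->
  `|H b - H a| <=
    K * (nu^-1 + e^-1 ^+ 2 + (1 - nu)^-1 * e^-1 ^+ 2) * e `^ nu * t `^ (- nu).
Proof.
move=> /andP[nu0 nu1] e0 K0 t1 be bq cH dH dh hK h'K.
have t0 : 0 < t by exact: lt_le_trans t1.
(* With this cut both pieces have the same order k^nu: integration by parts yields k^(nu - 1) / t,
   and 1 / t = k / e. *)
set k := e / t; have k0 : 0 < k by rewrite divr_gt0.
have ke : k <= e by rewrite ler_pdivrMr// ler_peMr// ltW.
have akb : a + k <= b by rewrite be lerD2l.
have E : e `^ nu * t `^ (- nu) = k `^ nu by rewrite powR_div.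
have sub1 x : x \in `]a, a + k[ -> x \in `]a, b[.
  by rewrite !in_itv/= => /andP[-> xk] /=; exact: lt_le_trans akb.
have sub2 x : x \in `]a + k, b[ -> x \in `]a, b[.
  by rewrite !in_itv/= => /andP[xk ->]; rewrite andbT (lt_trans _ xk)// ltrDl.
have sub3 x : x \in `[a + k, b] -> x \in `]a, b].
  by rewrite !in_itv/= => /andP[xk ->]; rewrite andbT (lt_le_trans _ xk)// ltrDl.
have near_a : `|H (a + k) - H a| <= K / nu * k `^ nu.
  pose g x := K / nu * (x - a) `^ nu.
  have cg : {within `[a, a + k], continuous g}.
    by move=> x; apply: cvgMr; exact: continuous_powR_subr0.
  have dg x : x \in `]a, a + k[ -> is_derive x 1 g (K * (x - a) `^ (nu - 1)).
    rewrite in_itv/= => /andP[ax _]; have ? := is_derive_powR_subr nu ax.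
    by apply: is_derive_eq; rewrite /GRing.scale/=; field; rewrite gt_eqF.
  have cH1 : {within `[a, a + k], continuous H}.
    by apply: continuous_subspaceW cH; apply: subset_itvl; rewrite bnd_simp.
  have aak : a <= a + k by rewrite lerDl ltW.
  have hg x : x \in `]a, a + k[ ->
      `|h x * cos (t * (x - q) ^+ 2 + c)| <= K * (x - a) `^ (nu - 1).
    move=> /sub1 xab; rewrite normrM -[leRHS]mulr1 ler_pM//; last first.
      by rewrite ler_norml cos_geN1 cos_le1.
    by apply: hK; exact: subset_itv_oo_oc xab.
  have := increment_le aak cH1 cg (fun x xk => dH x (sub1 x xk)) dg hg.
  by rewrite /g subrr powR0 ?gt_eqF// mulr0 subr0 addrAC subrr add0r.
have far_a : `|H b - H (a + k)| <=
    K * (e^-1 ^+ 2 + (1 - nu)^-1 * e^-1 ^+ 2) * k `^ nu.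
  (* Each term of the majorant is at most K (x - a)^(nu - 2) / e: the first as |x - q| >= e, the
     second also because x - a <= e. *)
  pose G := K * 2 / e.
  pose g x := - (G / (1 - nu)) * (x - a) `^ (nu - 1).
  have qab : q \notin `[a + k, b].
    by rewrite in_itv/= negb_and -!ltNge; apply/orP; right; lra.
  have xq x : x \in `[a + k, b] -> e <= `|x - q|.
    rewrite in_itv/= => /andP[_ xb]; rewrite distrC ger0_norm; lra.
  have dg x : x \in `[a + k, b] -> is_derive x 1 g (G * (x - a) `^ (nu - 2)).
    move=> /sub3; rewrite in_itv/= => /andP[ax _].
    have ? := is_derive_powR_subr (nu - 1) ax.
    apply: is_derive_eq; rewrite /GRing.scale/= (_ : nu - 1 - 1 = nu - 2); last by ring.
    by field; rewrite subr_eq0 gt_eqF.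
  have cg := is_derive_within_continuous dg.
  have cH1 : {within `[a + k, b], continuous H}.
    by apply: continuous_subspaceW cH; apply: subset_itvr; rewrite bnd_simp lerDl ltW.
  have hg x : x \in `]a + k, b[ ->
      `|h' x| / `|x - q| + `|h x| / `|x - q| ^+ 2 <= G * (x - a) `^ (nu - 2).
    move=> /subset_itv_oo_cc xab; have xab' := sub3 _ xab.
    have ax : 0 < x - a by move: xab'; rewrite in_itv/= subr_gt0 => /andP[].
    have xae : x - a <= e by move: xab'; rewrite in_itv/= => /andP[_]; lra.
    have xq0 : 0 < `|x - q| by exact: lt_le_trans (xq _ xab).
    have h1 : `|h' x| / `|x - q| <= K * (x - a) `^ (nu - 2) / e.
      by apply: ler_pM => //; [exact: h'K|rewrite lef_pV2 ?posrE// xq].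
    have h2 : `|h x| / `|x - q| ^+ 2 <= K * (e * (x - a) `^ (nu - 2)) / e ^+ 2.
      apply: ler_pM => //; last first.
        rewrite lef_pV2 ?posrE ?exprn_gt0// lerXn2r ?nnegrE ?xq//; exact: ltW.
      rewrite (le_trans (hK _ xab'))// ler_wpM2l//.
      rewrite -(mulr_powRB1_gt0 _ ax) (_ : nu - 1 - 1 = nu - 2); last by ring.
      by rewrite ler_wpM2r// powR_ge0.
    rewrite (le_trans (lerD h1 h2))// /G.
    by rewrite le_eqVlt; apply/predU1P; left; field; rewrite gt_eqF.
  have dg' x : x \in `]a + k, b[ -> is_derive x 1 g (G * (x - a) `^ (nu - 2)).
    by move/subset_itv_oo_cc; exact: dg.
  have K2 := oscillatory_increment_le t0 akb qab cH1 cg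
    (fun x xk => dH x (sub2 x xk)) (fun x xk => dh x (sub3 x xk)) dg' hg.
  apply: (le_trans K2).
  have kin : a + k \in `[a + k, b] by rewrite in_itv/= lexx.
  have bin : b \in `[a + k, b] by rewrite in_itv/= lexx andbT.
  have hk : `|h (a + k)| / `|a + k - q| <= K * k `^ (nu - 1) / e.
    apply: ler_pM => //; last by rewrite lef_pV2 ?posrE ?xq// (lt_le_trans e0)// xq.
    by have := hK _ (sub3 _ kin); rewrite addrAC subrr add0r.
  have hb : `|h b| / `|b - q| <= K * k `^ (nu - 1) / e.
    apply: ler_pM => //; last by rewrite lef_pV2 ?posrE ?xq// (lt_le_trans e0)// xq.
    rewrite (le_trans (hK _ (sub3 _ bin)))// ler_wpM2l// ler_powR_npos//; lra.
  have gb : g b - g (a + k) <= G / (1 - nu) * k `^ (nu - 1).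
    rewrite /g !mulNr opprK addrAC subrr add0r gerDr oppr_le0 mulr_ge0 ?powR_ge0//.
    by rewrite /G !mulr_ge0 ?invr_ge0 ?subr_ge0// ltW.
  rewrite ler_pdivrMr ?mulr_gt0//.
  rewrite (le_trans (lerD (lerD hk hb) gb))//.
  rewrite -(mulr_powRB1_gt0 nu k0) /G.
  move: (k `^ (nu - 1)) => X; rewrite /k.
  rewrite le_eqVlt; apply/predU1P; left; field.
  by rewrite !gt_eqF// subr_gt0.
rewrite -mulrA E.
have -> : H b - H a = (H b - H (a + k)) + (H (a + k) - H a) by ring.
rewrite (le_trans (ler_normD _ _))// (le_trans (lerD far_a near_a))//.
by rewrite le_eqVlt; apply/predU1P; left; field; rewrite !gt_eqF// subr_gt0.
Qed.

End StationaryPhase.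

(** * Phase estimates around the stationary point *)

Section InteriorPhase.
Context {R : realType}.
Implicit Types (a b c d e q s t x y r delta L : R) (f h H : R -> R).

Lemma inv_le_powR t delta : 1 <= t -> delta <= 1 -> t^-1 <= t `^ (- delta).
Proof.
move=> t1 d1; have t0 : 0 < t by exact: lt_le_trans t1.
by rewrite -(powR_inv1 (ltW t0)) ler_powR// lerN2.
Qed.

(* Here [s] is the sign of [x - q]. *)
Lemma side_phase_le delta L e d a b q t c s h h' H :
  0 < delta < 1 -> 0 < e -> 0 <= L -> 1 <= t -> a <= b ->
  s ^+ 2 = 1 ->
  (forall x, x \in `[a, b] -> e / t <= s * (x - q) <= d) ->
  {within `[a, b], continuous H} ->
  (forall x, x \in `]a, b[ ->
     is_derive x 1 H (h x * cos (t * (x - q) ^+ 2 + c))) ->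
  (forall x, x \in `[a, b] -> is_derive x 1 h (h' x)) ->
  (forall x, x \in `[a, b] -> `|h x| <= L * `|x - q|) ->
  (forall x, x \in `[a, b] -> `|h' x| <= L) ->
  `|H b - H a| <=
    L * (1 + d `^ (1 - delta) * e `^ (delta - 1) / (1 - delta)) *
    t `^ (- delta).
Proof.
move=> /andP[d0 d1] e0 L0 t1 ab s2 sq cH dH dh hL h'L.
have t0 : 0 < t by exact: lt_le_trans t1.
set k := e / t in sq *; have k0 : 0 < k by rewrite divr_gt0.
have s1 : `|s| = 1.
  by apply/eqP; rewrite -(@eqrXn2 _ 2)//; rewrite -normrX s2 normr1 expr1n.
have rE x : x \in `[a, b] -> `|x - q| = s * (x - q).
  move=> /sq /andP[kx _]; rewrite -[LHS]mul1r -s1 -normrM ger0_norm//.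
  exact: le_trans (ltW k0) kx.
have r0 x : x \in `[a, b] -> 0 < s * (x - q).
  by move=> /sq /andP[kx _]; exact: lt_le_trans kx.
(* The majorant 2 L / |x - q| would integrate to a logarithm. Since |x - q| <= d, it is at most G |x
   - q|^(delta - 2), whose primitive has order k^(delta - 1); divided by t, this is of order
   t^-delta. *)
pose G := L * 2 * d `^ (1 - delta).
have G0 : 0 <= G by rewrite !mulr_ge0// powR_ge0.
pose g x := - s * (G / (1 - delta)) * (s * (x - q)) `^ (delta - 1).
have qab : q \notin `[a, b].
  by apply/negP => /r0; rewrite subrr mulr0 ltxx.
have dg x : x \in `[a, b] -> is_derive x 1 g (G * (s * (x - q)) `^ (delta - 2)).
  move=> xab.
  have ds : is_derive x 1 (fun x => s * (x - q)) s.
    by apply: is_derive_eq; rewrite /GRing.scale/=; ring.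
  have := @is_derive1_comp R (fun y => y `^ (delta - 1)) (fun x => s * (x - q))
    x _ _ (@is_derive1_powR R (delta - 1) _ (r0 x xab)) ds.
  rewrite (_ : delta - 1 - 1 = delta - 2) => [?|]; last by ring.
  apply: is_derive_eq; rewrite /GRing.scale/=.
  transitivity (s ^+ 2 * G * (s * (x - q)) `^ (delta - 2)).
    by field; rewrite subr_eq0 gt_eqF.
  by rewrite s2 mul1r.
have cg := is_derive_within_continuous dg.
have hg x : x \in `]a, b[ ->
    `|h' x| / `|x - q| + `|h x| / `|x - q| ^+ 2 <=
    G * (s * (x - q)) `^ (delta - 2).
  move=> /subset_itv_oo_cc xab; have xr := r0 _ xab.
  have xn0 : 0 < `|x - q| by rewrite rE.
  have h1 : `|h' x| / `|x - q| <= L / `|x - q|.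
    by rewrite ler_pM2r ?invr_gt0// h'L.
  have h2 : `|h x| / `|x - q| ^+ 2 <= L / `|x - q|.
    rewrite ler_pdivrMr ?exprn_gt0// (le_trans (hL _ xab))//.
    by rewrite expr2 mulrA mulfVK ?gt_eqF.
  rewrite (le_trans (lerD h1 h2))// /G.
  have -> : L / `|x - q| + L / `|x - q| = L * 2 * `|x - q|^-1 by ring.
  have -> : `|x - q|^-1 = (s * (x - q)) `^ (1 - delta) * (s * (x - q)) `^ (delta - 2).
    rewrite -powRD; last by rewrite (gt_eqF xr) implybT.
    rewrite (_ : 1 - delta + (delta - 2) = -1); last by ring.
    by rewrite rE// powR_inv1// ltW.
  rewrite mulrA ler_wpM2r ?powR_ge0// ler_wpM2l ?mulr_ge0//.
  have /andP[_ xd] := sq _ xab.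
  apply: ge0_ler_powR; rewrite ?nnegrE ?subr_ge0//; try exact: ltW.
  exact: le_trans (ltW xr) xd.
have dg' x : x \in `]a, b[ -> is_derive x 1 g (G * (s * (x - q)) `^ (delta - 2)).
  by move/subset_itv_oo_cc; exact: dg.
apply: (le_trans (oscillatory_increment_le t0 ab qab cH cg dH dh dg' hg)).
have ain : a \in `[a, b] by rewrite in_itv/= lexx.
have bin : b \in `[a, b] by rewrite in_itv/= lexx andbT.
have hx x : x \in `[a, b] -> `|h x| / `|x - q| <= L.
  by move=> xab; rewrite ler_pdivrMr ?rE ?r0// -rE// hL.
have pk x : x \in `[a, b] -> (s * (x - q)) `^ (delta - 1) <= k `^ (delta - 1).
  by move=> /sq /andP[kx _]; rewrite ler_powR_npos// subr_le0 ltW.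
have gb : g b - g a <= G / (1 - delta) * k `^ (delta - 1).
  have -> : g b - g a = G / (1 - delta) *
      (- s * ((s * (b - q)) `^ (delta - 1) - (s * (a - q)) `^ (delta - 1))).
    by rewrite /g; ring.
  rewrite ler_wpM2l ?divr_ge0 ?subr_ge0 ?(ltW d1)//.
  rewrite (le_trans (ler_norm _))// normrM normrN s1 mul1r.
  have := pk _ ain; have := pk _ bin.
  have := powR_ge0 (s * (a - q)) (delta - 1).
  have := powR_ge0 (s * (b - q)) (delta - 1).
  by rewrite ler_norml; lra.
rewrite (le_trans (ler_wpM2r _ (lerD (lerD (hx _ ain) (hx _ bin)) gb)))//.
  by rewrite invr_ge0 mulr_ge0// ltW.
have -> : (L + L + G / (1 - delta) * k `^ (delta - 1)) / (2 * t) =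
  L * (t^-1 + d `^ (1 - delta) / (1 - delta) * (k `^ (delta - 1) / t)).
  by rewrite /G; field; rewrite subr_eq0 !gt_eqF.
rewrite -[leRHS]mulrA ler_wpM2l// mulrDl mul1r lerD ?inv_le_powR ?(ltW d1)//.
rewrite /k powR_div// le_eqVlt; apply/predU1P; left.
have -> : - (delta - 1) = - delta + 1 by ring.
rewrite (@powRD _ t); last by rewrite (gt_eqF t0) implybT.
rewrite (powRr1 (ltW t0)).
by field; rewrite subr_eq0 !gt_eqF.
Qed.

(** Each side of q falls under [side_phase_le]; the middle, of length at most 2 e / t, is bounded by
    the size of [h]. As q may be arbitrarily close to b, the bound is uniform up to the right
    endpoint. *)
Lemma interior_phase_le delta L e d a b q t c h h' H :
  0 < delta < 1 -> 0 < e -> 0 <= L -> 1 <= t -> a + e <= q -> q <= b ->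
  b - a <= d ->
  {within `[a, b], continuous H} ->
  (forall x, x \in `]a, b[ ->
     is_derive x 1 H (h x * cos (t * (x - q) ^+ 2 + c))) ->
  (forall x, x \in `[a, b] -> is_derive x 1 h (h' x)) ->
  (forall x, x \in `[a, b] -> `|h x| <= L * `|x - q|) ->
  (forall x, x \in `[a, b] -> `|h' x| <= L) ->
  `|H b - H a| <=
    L * (2 * (1 + d `^ (1 - delta) * e `^ (delta - 1) / (1 - delta))
         + 2 * e ^+ 2) * t `^ (- delta).
Proof.
move=> dd e0 L0 t1 aq qb bad cH dH dh hL h'L.
have t0 : 0 < t by exact: lt_le_trans t1.
set k := e / t; have k0 : 0 < k by rewrite divr_gt0.
have ke : k <= e by rewrite ler_pdivrMr// ler_peMr// ltW.
have sub x y z : a <= x -> y <= b -> z \in `[x, y] -> z \in `[a, b].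
  by move=> ax yb; rewrite !in_itv/=; lra.
have subo x y z : a <= x -> y <= b -> z \in `]x, y[ -> z \in `]a, b[.
  by move=> ax yb; rewrite !in_itv/=; lra.
have csub x y : a <= x -> y <= b -> {within `[x, y], continuous H}.
  by move=> ax yb; apply: continuous_subspaceW cH => z /=; exact: sub.
set C0 := 1 + _ / _.
have C00 : 0 <= C0.
  by rewrite addr_ge0// divr_ge0 ?mulr_ge0 ?powR_ge0// subr_ge0; case/andP: dd => _ /ltW.
have left : `|H (q - k) - H a| <= L * C0 * t `^ (- delta).
  have a1 : a <= a by [].
  have b1 : q - k <= b by lra.
  apply: (@side_phase_le delta L e d a (q - k) q t c (-1) h h' H) => //.
  - lra.
  - by rewrite sqrrN expr1n.
  - by move=> x; rewrite in_itv/= -/k; lra.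
  - exact: csub.
  - by move=> x xa; apply: dH; exact: subo xa.
  - by move=> x xa; apply: dh; exact: sub xa.
  - by move=> x xa; apply: hL; exact: sub xa.
  - by move=> x xa; apply: h'L; exact: sub xa.
have mid y : q - k <= y -> y <= b -> y <= q + k ->
    `|H y - H (q - k)| <= L * (2 * e ^+ 2) * t `^ (- delta).
  move=> qy yb yqk; have a1 : a <= q - k by lra.
  pose g x := L * e * x.
  have dg x : is_derive x 1 g (L * e).
    by apply: is_derive_eq; rewrite /GRing.scale/=; ring.
  have cg : {within `[q - k, y], continuous g}.
    exact: (@is_derive_within_continuous _ g (fun=> L * e) _ _ (fun x _ => dg x)).
  (* The crude L e is enough, since the length of the interval already supplies 1 / t. *)
  have hg x : x \in `]q - k, y[ -> `|h x * cos (t * (x - q) ^+ 2 + c)| <= L * e.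
    move=> xy; rewrite normrM -[leRHS]mulr1 ler_pM//; last first.
      by rewrite ler_norml cos_geN1 cos_le1.
    rewrite (le_trans (hL _ _))//; first exact/(sub _ _ _ a1 yb)/subset_itv_oo_cc.
    rewrite ler_wpM2l//; move: xy; rewrite in_itv/= => xy.
    by rewrite ler_norml; lra.
  apply: (le_trans (increment_le qy (csub _ _ a1 yb) cg
    (fun x xy => dH x (subo _ _ _ a1 yb xy)) (fun x _ => dg x) hg)).
  rewrite /g -mulrBr -!mulrA ler_wpM2l// mulrA.
  apply: (@le_trans _ _ (e * (2 * k))).
    by rewrite ler_wpM2l ?(ltW e0)//; lra.
  have -> : e * (2 * k) = 2 * e ^+ 2 * t^-1 by rewrite /k; ring.
  have -> : 2 * e * (e * t `^ (- delta)) = 2 * e ^+ 2 * t `^ (- delta) by ring.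
  rewrite ler_wpM2l ?mulr_ge0 ?exprn_ge0 ?(ltW e0)//.
  by apply: inv_le_powR => //; case/andP: dd => _ /ltW.
have qkb : q - k <= b by lra.
have qkk : q - k <= q + k by lra.
(* If q is within e / t of b, the middle piece ends at b and no right piece remains. *)
have [bq|qb'] := leP b (q + k).
  have -> : H b - H a = (H (q - k) - H a) + (H b - H (q - k)) by ring.
  have m := mid b qkb (lexx b) bq.
  rewrite (le_trans (ler_normD _ _))// (le_trans (lerD left m))//.
  have : 0 <= L * C0 * t `^ (- delta) by rewrite !mulr_ge0// powR_ge0.
  lra.
have m := mid (q + k) qkk (ltW qb') (lexx _).
have right : `|H b - H (q + k)| <= L * C0 * t `^ (- delta).
  have a1 : a <= q + k by lra.
  have s2 : (1 : R) ^+ 2 = 1 by rewrite expr1n.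
  have sq x : x \in `[q + k, b] -> e / t <= 1 * (x - q) <= d.
    by rewrite mul1r in_itv/= -/k; lra.
  exact: (side_phase_le dd e0 L0 t1 (ltW qb') s2 sq (csub _ _ a1 (lexx b))
    (fun x xb => dH x (subo _ _ _ a1 (lexx b) xb))
    (fun x xb => dh x (sub _ _ _ a1 (lexx b) xb))
    (fun x xb => hL x (sub _ _ _ a1 (lexx b) xb))
    (fun x xb => h'L x (sub _ _ _ a1 (lexx b) xb))).
have -> : H b - H a =
    (H (q - k) - H a) + (H (q + k) - H (q - k)) + (H b - H (q + k)) by ring.
rewrite (le_trans (ler_normD _ _))// (le_trans (lerD (ler_normD _ _) right))//.
rewrite (le_trans (lerD (lerD left m) (lexx _)))//.
by rewrite le_eqVlt; apply/predU1P; left; ring.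
Qed.

End InteriorPhase.

(** * Uniform phase estimates for an amplitude singular at p1 *)

Section SingularPhase.
Context {R : realType}.
Implicit Types (c p q t x y nu delta eps K : R) (f H : R -> R).

Lemma lipschitz_of_derive_le f f' L a b :
  (forall x, x \in `[a, b] -> is_derive x 1 f (f' x)) ->
  (forall x, x \in `[a, b] -> `|f' x| <= L) ->
  forall x y, x \in `[a, b] -> y \in `[a, b] -> `|f x - f y| <= L * `|x - y|.
Proof.
move=> df f'L.
have main x y : x <= y -> x \in `[a, b] -> y \in `[a, b] ->
    `|f y - f x| <= L * (y - x).
  move=> xy xab yab.
  have sub z : z \in `[x, y] -> z \in `[a, b].
    by move: xab yab; rewrite !in_itv/=; lra.
  have dxy z : z \in `[x, y] -> is_derive z 1 f (f' z) by move/sub/df.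
  have cf := is_derive_within_continuous dxy.
  have [z zxy ->] := MVT_segment xy (fun z zxy => dxy z (subset_itv_oo_cc zxy)) cf.
  by rewrite normrM (@ger0_norm _ (y - x)) ?subr_ge0// ler_wpM2r ?subr_ge0// f'L// sub.
move=> x y xab yab; have [xy|yx] := leP x y.
  by rewrite distrC (distrC x) (@ger0_norm _ (y - x)) ?subr_ge0// main.
by rewrite (@ger0_norm _ (x - y)) ?subr_ge0 ?(ltW yx)//; exact: main (ltW yx) yab xab.
Qed.

(** The amplitude f - f q vanishes at q and keeps at p1 the singularity of f, so the endpoint and
    interior estimates apply on either side of p1 + eps / 2. [C] precedes q because the bound is
    later integrated over all stationary points. *)
Lemma singular_phase_le nu delta eps K p1 p2 f f' :
  0 < nu < 1 -> 0 < delta < 1 -> 0 < eps -> p1 + eps < p2 -> 0 <= K ->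
  (forall x, x \in `]p1, p2] -> is_derive x 1 f (f' x)) ->
  (forall x, x \in `]p1, p2] -> `|f x| <= K * (x - p1) `^ (nu - 1)) ->
  (forall x, x \in `]p1, p2] -> `|f' x| <= K * (x - p1) `^ (nu - 2)) ->
  exists2 C : R, 0 <= C & forall t c q H,
    1 <= t -> q \in `]p1 + eps, p2[ ->
    {within `[p1, p2], continuous H} ->
    (forall x, x \in `]p1, p2[ ->
      is_derive x 1 H ((f x - f q) * cos (t * (x - q) ^+ 2 + c))) ->
    `|H p2 - H p1| <= C * (t `^ (- nu) + t `^ (- delta)).
Proof.
move=> nu01 d01 eps0 p12 K0 df fK f'K.
have [/andP[nu0 nu1] /andP[d0 d1]] := (nu01, d01).
pose e := eps / 2; have e0 : 0 < e by rewrite /e; lra.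
pose m := p1 + e.
(* [K2] absorbs the constant [f q] into the singular bound: |f q| <= K eps^(nu - 1), while (x -
   p1)^(nu - 1) >= (p2 - p1)^(nu - 1). *)
pose K2 := K * (1 + eps `^ (nu - 1) / (p2 - p1) `^ (nu - 1)).
have KK2 : K <= K2.
  by rewrite -[leLHS]mulr1 ler_wpM2l// lerDl divr_ge0 ?powR_ge0.
have K20 : 0 <= K2 by exact: le_trans KK2.
(* A bound of f' on [m, p2], hence a Lipschitz constant of f there. *)
pose L := K * e `^ (nu - 2).
have L0 : 0 <= L by rewrite mulr_ge0 ?powR_ge0.
pose C1 := K2 * (nu^-1 + e^-1 ^+ 2 + (1 - nu)^-1 * e^-1 ^+ 2) * e `^ nu.
pose C2 := L * (2 * (1 + (p2 - p1) `^ (1 - delta) * e `^ (delta - 1) / (1 - delta))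
         + 2 * e ^+ 2).
have C10 : 0 <= C1.
  rewrite mulr_ge0 ?powR_ge0// mulr_ge0//.
  by rewrite !addr_ge0 ?mulr_ge0 ?exprn_ge0 ?invr_ge0 ?(ltW nu0) ?(ltW e0)//
    subr_ge0 ltW.
have C20 : 0 <= C2.
  have h1 : 0 <= (p2 - p1) `^ (1 - delta) * e `^ (delta - 1) / (1 - delta).
    by rewrite !mulr_ge0 ?powR_ge0// invr_ge0 subr_ge0 ltW.
  have h2 : 0 <= e ^+ 2 by rewrite sqr_ge0.
  by rewrite mulr_ge0//; lra.
exists (C1 + C2); first exact: addr_ge0.
move=> t c q H t1 qe cH dH.
have /andP[q1 q2] : p1 + eps < q < p2 by move: qe; rewrite in_itv.
have qin : q \in `]p1, p2] by rewrite in_itv/=; lra.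
pose h x := f x - f q.
have sub1 x : x \in `]p1, m] -> x \in `]p1, p2].
  by rewrite !in_itv/= /m /e; lra.
have sub1o x : x \in `]p1, m[ -> x \in `]p1, p2[.
  by rewrite !in_itv/= /m /e; lra.
have sub2 x : x \in `[m, p2] -> x \in `]p1, p2].
  by rewrite !in_itv/= /m /e; lra.
have sub2o x : x \in `]m, p2[ -> x \in `]p1, p2[.
  by rewrite !in_itv/= /m /e; lra.
have dh x : x \in `]p1, p2] -> is_derive x 1 h (f' x).
  by move=> /df ?; apply: is_derive_eq; rewrite subr0.
have hK2 x : x \in `]p1, p2] -> `|h x| <= K2 * (x - p1) `^ (nu - 1).
  move=> xp; rewrite (le_trans (ler_normB _ _))//.
  have x0 : 0 < x - p1 by move: xp; rewrite in_itv/= subr_gt0 => /andP[].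
  have xd : x - p1 <= p2 - p1 by move: xp; rewrite in_itv/= lerD2r => /andP[].
  have P0 : 0 < (p2 - p1) `^ (nu - 1) by rewrite powR_gt0; lra.
  have fq : `|f q| <= K * eps `^ (nu - 1).
    rewrite (le_trans (fK _ qin))// ler_wpM2l// ler_powR_npos//; lra.
  have px : (p2 - p1) `^ (nu - 1) <= (x - p1) `^ (nu - 1).
    by rewrite ler_powR_npos//; lra.
  rewrite (le_trans (lerD (fK _ xp) fq))// /K2 mulrDr mulr1 mulrDl lerD2l.
  rewrite -!mulrA ler_wpM2l// -[leLHS]mulr1 ler_wpM2l ?powR_ge0//.
  by rewrite mulrC ler_pdivlMr// mul1r.
have mp : m <= p2 by rewrite /m /e; lra.
have pm : p1 <= m by rewrite /m; lra.
have left : `|H m - H p1| <= C1 * t `^ (- nu).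
  have mq : m + e <= q by rewrite /m /e; lra.
  have cH1 : {within `[p1, m], continuous H}.
    by apply: continuous_subspaceW cH; apply: subset_itvl; rewrite bnd_simp.
  have f'K2 x : x \in `]p1, m] -> `|f' x| <= K2 * (x - p1) `^ (nu - 2).
    move=> /sub1 xp; rewrite (le_trans (f'K _ xp))// ler_wpM2r ?powR_ge0//.
  exact: (endpoint_phase_le nu01 e0 K20 t1 (erefl m) mq cH1
    (fun x xm => dH x (sub1o x xm)) (fun x xm => dh x (sub1 x xm))
    (fun x xm => hK2 x (sub1 x xm)) f'K2).
have right : `|H p2 - H m| <= C2 * t `^ (- delta).
  have mq : m + e <= q by rewrite /m /e; lra.
  have dm : p2 - m <= p2 - p1 by lra.
  have cH2 : {within `[m, p2], continuous H}.
    by apply: continuous_subspaceW cH; apply: subset_itvr; rewrite bnd_simp.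
  have f'L x : x \in `[m, p2] -> `|f' x| <= L.
    move=> xp; rewrite (le_trans (f'K _ (sub2 _ xp)))// ler_wpM2l//.
    by rewrite ler_powR_npos//; move: xp; rewrite in_itv/= /m; lra.
  have dfm x : x \in `[m, p2] -> is_derive x 1 f (f' x) by move/sub2/df.
  have hL x : x \in `[m, p2] -> `|h x| <= L * `|x - q|.
    move=> xp; apply: (lipschitz_of_derive_le dfm f'L xp).
    by rewrite in_itv/=; lra.
  exact: (interior_phase_le d01 e0 L0 t1 mq (ltW q2) dm cH2
    (fun x xm => dH x (sub2o x xm)) (fun x xm => dh x (sub2 x xm)) hL f'L).
have -> : H p2 - H p1 = (H p2 - H m) + (H m - H p1) by ring.
rewrite (le_trans (ler_normD _ _))// (le_trans (lerD right left))//.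
rewrite mulrDl !mulrDr.
have h1 : 0 <= C1 * t `^ (- delta) by rewrite mulr_ge0 ?powR_ge0.
have h2 : 0 <= C2 * t `^ (- nu) by rewrite mulr_ge0 ?powR_ge0.
lra.
Qed.

End SingularPhase.

(** * A quadratic identity for truncated Fresnel integrals *)

Section FresnelDerivative.
Context {R : realType}.
Notation mu := (@lebesgue_measure R).
Implicit Types (a b c x y : R) (g G : R -> R).

Lemma is_derive_continuous g (d : R) x : is_derive x 1 g d -> {for x, continuous g}.
Proof.
by move=> [dg _]; apply: differentiable_continuous; exact/derivable1_diffP.
Qed.

Lemma continuous_itv_integrable g a b :
  (forall x, x \in `[a, b] -> {for x, continuous g}) ->
  mu.-integrable `[a, b] (EFin \o g).
Proof.
move=> cg; apply: continuous_compact_integrable; first exact: segment_compact.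
by apply: continuous_in_subspaceT => x /set_mem; exact: cg.
Qed.

Lemma Rintegral_derive g G a b : a <= b ->
  (forall x, x \in `[a, b] -> {for x, continuous g}) ->
  (forall x, x \in `[a, b] -> is_derive x 1 G (g x)) ->
  Rintegral mu `[a, b] g = G b - G a.
Proof.
rewrite le_eqVlt => /predU1P[<- _ _|ab cg dG].
  by rewrite set_itv1 Rintegral_set1 subrr.
have oc x : x \in `]a, b[ -> x \in `[a, b] by exact: subset_itv_oo_cc.
have [H [cH dH ->]] := integrable_exists_primitive ab
  (continuous_itv_integrable cg) (fun x xab => cg x (oc x xab)).
pose D x := H x - G x.
have cD : {within `[a, b], continuous D}.
  by move=> x; apply: cvgB; [exact: cH|exact: (is_derive_within_continuous dG)].
have dD x : x \in `]a, b[ -> is_derive x 1 D ((fun=> 0) x).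
  move=> xab; have := dH x xab; have := dG x (oc x xab) => ? ?.
  by apply: is_derive_eq; rewrite subrr.
have [x _] := MVT_segment (ltW ab) dD cD.
rewrite /D mul0r => /eqP; rewrite subr_eq0 => /eqP.
lra.
Qed.

Lemma onePsqr_gt0 y : 0 < 1 + y ^+ 2.
Proof. by rewrite ltr_wpDr// sqr_ge0. Qed.

Lemma is_derive_inv_onePsqr y :
  is_derive y 1 (fun y => (1 + y ^+ 2)^-1) (- (2 * y) / (1 + y ^+ 2) ^+ 2).
Proof.
have n0 : 1 + y ^+ 2 != 0 by rewrite gt_eqF ?onePsqr_gt0.
have d1 : is_derive y 1 (fun y => 1 + y ^+ 2) (2 * y).
  by apply: is_derive_eq; rewrite /GRing.scale/=; ring.
have := @is_deriveV R (fun y => 1 + y ^+ 2) y _ 1 n0 d1.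
by rewrite /GRing.scale/= mulrC mulrN mulNr.
Qed.

Variables (Cf Sf : R -> R).
Hypothesis dCf : forall x, is_derive x 1 Cf (cos (x ^+ 2)).
Hypothesis dSf : forall x, is_derive x 1 Sf (sin (x ^+ 2)).
Hypothesis Cf0 : Cf 0 = 0.
Hypothesis Sf0 : Sf 0 = 0.

(** The kernel of the classical evaluation of the Gaussian integral by a parameter x, with an
    oscillating phase in place of the decaying exponential. *)
Let phi c x y := cos (x ^+ 2 * (1 + y ^+ 2) + c) * (1 + y ^+ 2)^-1.
Let Phi c x := Rintegral mu `[0, 1] (phi c x).

Let dphi_y c x y : is_derive y 1 (phi c x)
  (- (x ^+ 2 * (2 * y) * sin (x ^+ 2 * (1 + y ^+ 2) + c)) * (1 + y ^+ 2)^-1 +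
   cos (x ^+ 2 * (1 + y ^+ 2) + c) * (- (2 * y) / (1 + y ^+ 2) ^+ 2)).
Proof.
have ? := is_derive_inv_onePsqr y.
by apply: is_derive_eq; rewrite /GRing.scale/=; ring.
Qed.

Let dphi_x c x y : is_derive x 1 (phi c ^~ y)
  (- (2 * x * sin (x ^+ 2 * (1 + y ^+ 2) + c))).
Proof.
apply: is_derive_eq; rewrite /GRing.scale/=.
by field; rewrite gt_eqF ?onePsqr_gt0.
Qed.

(** The phase splits as (x^2 + c) + (x y)^2, so substituting x y for y leaves [Cf x] and [Sf x].
    Made on primitives, the substitution covers x = 0 as well. *)
Let integral_dphi_x c x :
  Rintegral mu `[0, 1] (fun y => - (2 * x * sin (x ^+ 2 * (1 + y ^+ 2) + c))) =
  - 2 * (Cf x * sin (x ^+ 2 + c) + Sf x * cos (x ^+ 2 + c)).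
Proof.
pose G y := - 2 * (Cf (x * y) * sin (x ^+ 2 + c) + Sf (x * y) * cos (x ^+ 2 + c)).
transitivity (G 1 - G 0); last first.
  by rewrite /G mulr1 mulr0 Cf0 Sf0 !mul0r addr0 mulr0 subr0.
apply: Rintegral_derive; first exact: ler01.
- move=> y _.
  have d : is_derive y 1 (fun y => - (2 * x * sin (x ^+ 2 * (1 + y ^+ 2) + c)))
      (- (2 * x * (x ^+ 2 * (2 * y) * cos (x ^+ 2 * (1 + y ^+ 2) + c)))).
    by apply: is_derive_eq; rewrite /GRing.scale/=; ring.
  exact: is_derive_continuous d.
- move=> y _.
  have dm : is_derive y 1 (fun y => x * y) x.
    by apply: is_derive_eq; rewrite /GRing.scale/=; ring.
  have dC := @is_derive1_comp R Cf (fun y => x * y) y _ _ (dCf (x * y)) dm.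
  have dS := @is_derive1_comp R Sf (fun y => x * y) y _ _ (dSf (x * y)) dm.
  have dC' : is_derive y 1 (fun y => Cf (x * y)) (cos ((x * y) ^+ 2) * x) by [].
  have dS' : is_derive y 1 (fun y => Sf (x * y)) (sin ((x * y) ^+ 2) * x) by [].
  apply: is_derive_eq; rewrite /GRing.scale/=.
  rewrite (_ : x ^+ 2 * (1 + y ^+ 2) + c = (x ^+ 2 + c) + (x * y) ^+ 2); last by ring.
  by rewrite [sin (_ + (x * y) ^+ 2)]sinD; ring.
Qed.

Let dPhi c x : is_derive x 1 (Phi c)
  (- 2 * (Cf x * sin (x ^+ 2 + c) + Sf x * cos (x ^+ 2 + c))).
Proof.
have xI : (`]x - 1, x + 1[%classic : set R) x by rewrite /= in_itv/=; lra.
have mI : measurable (`[0, 1]%classic : set (measurableTypeR R)).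
  exact: measurable_itv.
have iphi z : `]x - 1, x + 1[%classic z -> mu.-integrable `[0, 1] (EFin \o phi c z).
  by move=> _; apply: continuous_itv_integrable => y _;
    exact: is_derive_continuous (dphi_y c z y).
have dphi z y : `]x - 1, x + 1[%classic z -> `[0, 1]%classic y ->
    derivable (phi c ^~ y) z 1 by move=> _ _; have [] := dphi_x c z y.
(* Dominates the x-derivative of the kernel, 2 |z sin| at most, for every z in ]x - 1, x + 1[. *)
pose M (y : measurableTypeR R) := 2 * (`|x| + 1).
have M0 y : 0 <= M y by rewrite /M mulr_ge0// addr_ge0.
have iM : mu.-integrable `[0, 1] (EFin \o M).
  by apply: continuous_itv_integrable => y _; exact: cvg_cst.
have p1E z y : partial1of2 (phi c) z y = - (2 * z * sin (z ^+ 2 * (1 + y ^+ 2) + c)).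
  by rewrite partial1of2E; have [_ ->] := dphi_x c z y.
have bM z y : `]x - 1, x + 1[%classic z -> `[0, 1]%classic y ->
    `|partial1of2 (phi c) z y| <= M y.
  rewrite /= in_itv/= => zx _; rewrite p1E normrN 2!normrM /M (@ger0_norm _ 2)//.
  rewrite -mulrA ler_wpM2l// -[leRHS]mulr1 ler_pM//; last first.
    by rewrite ler_norml sin_geN1 sin_le1.
  rewrite -(subrK x z) addrC (le_trans (ler_normD _ _))// lerD2l.
  by rewrite ler_norml; lra.
have D1 := derivable_under_integral mI xI iphi dphi M0 iM bM.
have D2 := differentiation_under_integral mI xI iphi dphi M0 iM bM.
apply: DeriveDef; first exact: D1.
rewrite -derive1E -integral_dphi_x [LHS]D2.
by apply: eq_Rintegral => y _; exact: p1E.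
Qed.

(* With Gamma = Cf - i Sf, this is (a real combination of the real and imaginary
   parts of) Gamma(x)^2 = - i pi/4 + i \int_0^1 exp(-i x^2 (1 + y^2)) / (1 + y^2) dy:
   both sides have the same derivative in x, and agree at 0. *)
Lemma fresnel_identity c x :
  cos c * (2 * (Cf x * Sf x)) + sin c * (Cf x ^+ 2 - Sf x ^+ 2) =
  cos c * (pi / 4) -
  Rintegral mu `[0, 1]
    (fun y => cos (x ^+ 2 * (1 + y ^+ 2) + c) * (1 + y ^+ 2)^-1).
Proof.
pose P x := cos c * (2 * (Cf x * Sf x)) + sin c * (Cf x ^+ 2 - Sf x ^+ 2) + Phi c x.
have dP (z : R) : is_derive z 1 P 0.
  have := dPhi c z; have := dCf z; have := dSf z => ? ? ?.
  apply: is_derive_eq; rewrite /GRing.scale/= sinD cosD; ring.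
have P0 : P 0 = cos c * (pi / 4).
  rewrite /P Cf0 Sf0 !(mulr0, mul0r, expr0n)/= subr0 mulr0 !add0r /Phi.
  transitivity (cos c * atan 1 - cos c * atan 0); last first.
    by rewrite atan1 atan0 mulr0 subr0.
  apply: (@Rintegral_derive _ (fun y => cos c * atan y)); first exact: ler01.
  - by move=> y _; exact: is_derive_continuous (dphi_y c 0 y).
  - move=> y _; have ? := is_derive1_atan y.
    apply: is_derive_eq; rewrite /phi expr0n/= mul0r add0r /GRing.scale/=; ring.
by rewrite -P0 (@is_derive_0_is_cst _ P 0 x dP) /P addrK.
Qed.

End FresnelDerivative.

(** * Decay of truncated Fresnel integrals *)

Section FresnelBounds.
Context {R : realType}.
Notation mu := (@lebesgue_measure R).
Implicit Types (a b c x y z : R) (H : R -> R).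

(** In y the phase is stationary at 0: for x > 1 the interval [0, 1 / x] contributes at most 1 / x,
    and integration by parts on the rest at most 2 / x. For x <= 1 the trivial bound 1 is below 3 /
    x. *)
Lemma fresnel_phase_integral_le c x : 0 < x ->
  `|Rintegral mu `[0, 1]
    (fun y => cos (x ^+ 2 * (1 + y ^+ 2) + c) * (1 + y ^+ 2)^-1)| <= 3 / x.
Proof.
move=> x0; set h := fun y => _.
have onePsqrV_le1 y : `|(1 + y ^+ 2)^-1| <= 1.
  have ge1 : 1 <= 1 + y ^+ 2 by rewrite lerDl sqr_ge0.
  by rewrite gtr0_norm ?invr_gt0 ?onePsqr_gt0// invf_le1 ?onePsqr_gt0.
have ch y : {for y, continuous h}.
  have ? := is_derive_inv_onePsqr y.
  have d : is_derive y 1 h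
      (- (x ^+ 2 * (2 * y) * sin (x ^+ 2 * (1 + y ^+ 2) + c)) * (1 + y ^+ 2)^-1 +
       cos (x ^+ 2 * (1 + y ^+ 2) + c) * (- (2 * y) / (1 + y ^+ 2) ^+ 2)).
    by apply: is_derive_eq; rewrite /GRing.scale/=; ring.
  exact: is_derive_continuous d.
have [H [cH dH ->]] := integrable_exists_primitive (@ltr01 R)
  (continuous_itv_integrable (fun y _ => ch y)) (fun y _ => ch y).
have trivial_le y : 0 <= y -> y <= 1 -> `|H y - H 0| <= y.
  move=> y0 y1.
  have cHy : {within `[0, y], continuous H}.
    by apply: continuous_subspaceW cH; apply: subset_itvl; rewrite bnd_simp.
  have dHy z : z \in `]0, y[ -> is_derive z 1 H (h z).
    by move=> zy; apply: dH; move: zy; rewrite !in_itv/=; lra.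
  have did z : z \in `]0, y[ -> is_derive z 1 (fun z : R => z) ((fun=> 1) z).
    by move=> _; exact: is_derive_id.
  have cid : {within `[0, y], continuous (fun z : R => z)}.
    by apply: continuous_subspaceT => z; exact: cvg_id.
  have hle z : z \in `]0, y[ -> `|h z| <= (fun=> 1) z.
    move=> _; rewrite /h normrM -[leRHS]mulr1 ler_pM//.
    by rewrite ler_norml cos_geN1 cos_le1.
  by have := increment_le y0 cHy cid dHy did hle; rewrite subr0.
have [x1|x1] := leP x 1.
  rewrite (le_trans (trivial_le 1 ler01 (lexx 1)))//.
  by rewrite ler_pdivlMr// mul1r; lra.
pose k := x^-1; have k0 : 0 < k by rewrite invr_gt0.
have k1 : k <= 1 by rewrite invf_le1// ltW.
pose h0 y := (1 + y ^+ 2)^-1.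
pose h0' y := - (2 * y) / (1 + y ^+ 2) ^+ 2.
have x20 : 0 < x ^+ 2 by rewrite exprn_gt0.
have q : 0 \notin `[k, 1] by rewrite in_itv/= negb_and -!ltNge k0.
have cHk : {within `[k, 1], continuous H}.
  by apply: continuous_subspaceW cH; apply: subset_itvr; rewrite bnd_simp ltW.
have dHk y : y \in `]k, 1[ ->
    is_derive y 1 H (h0 y * cos (x ^+ 2 * (y - 0) ^+ 2 + (x ^+ 2 + c))).
  move=> yk; have -> : h0 y * cos (x ^+ 2 * (y - 0) ^+ 2 + (x ^+ 2 + c)) = h y.
    rewrite /h /h0 mulrC subr0; congr (cos _ * _); ring.
  by apply: dH; move: yk; rewrite !in_itv/=; lra.
have dh0 y : y \in `[k, 1] -> is_derive y 1 h0 (h0' y).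
  by move=> _; exact: is_derive_inv_onePsqr.
(* The 3 is 2 + 1: |h0' y| / y <= 2 <= 2 / y^2 because y <= 1, and the other term of the majorant is
   at most 1 / y^2. *)
pose g y := - 3 * (y - 0)^-1.
have dg y : y \in `[k, 1] -> is_derive y 1 g (3 * y ^- 2).
  rewrite in_itv/= => /andP[ky _].
  have n0 : y - 0 != 0 by rewrite subr0 gt_eqF// (lt_le_trans k0).
  have := is_derive_subr_inv n0 => ?.
  by apply: is_derive_eq; rewrite /GRing.scale/= subr0; ring.
have cg := is_derive_within_continuous dg.
have dg' y : y \in `]k, 1[ -> is_derive y 1 g (3 * y ^- 2).
  by move/subset_itv_oo_cc; exact: dg.
have hg y : y \in `]k, 1[ ->
    `|h0' y| / `|y - 0| + `|h0 y| / `|y - 0| ^+ 2 <= 3 * y ^- 2.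
  rewrite in_itv/= subr0 => /andP[ky y1].
  have y0 : 0 < y by exact: lt_trans ky.
  have yV : 1 <= y ^- 2 by rewrite invf_ge1 ?exprn_gt0// exprn_ile1// ltW.
  rewrite (@gtr0_norm _ y)//.
  have -> : `|h0' y| / y = 2 * `|(1 + y ^+ 2)^-1| ^+ 2.
    rewrite /h0' -exprVn normrM normrN (@gtr0_norm _ (2 * y)) ?mulr_gt0// normrX.
    by field; rewrite gt_eqF.
  have h1 : `|(1 + y ^+ 2)^-1| ^+ 2 <= 1 by rewrite exprn_ile1.
  have h2 : `|h0 y| / y ^+ 2 <= y ^- 2.
    rewrite -[leRHS]mul1r ler_wpM2r ?invr_ge0 ?exprn_ge0 ?(ltW y0)//.
    exact: onePsqrV_le1.
  lra.
have far := oscillatory_increment_le x20 k1 q cHk cg dHk dh0 dg' hg.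
have near := trivial_le k (ltW k0) k1.
have -> : H 1 - H 0 = (H 1 - H k) + (H k - H 0) by ring.
rewrite (le_trans (ler_normD _ _))// (le_trans (lerD far near))//.
rewrite -lerBrDr ler_pdivrMr ?mulr_gt0//.
have h0k : `|h0 k| / `|k - 0| <= x.
  rewrite subr0 (gtr0_norm k0) invrK -[leRHS]mul1r ler_wpM2r ?(ltW x0)//.
  exact: onePsqrV_le1.
have h01 : `|h0 1| / `|1 - 0| <= 1.
  by rewrite subr0 normr1 divr1; exact: onePsqrV_le1.
have gk : g 1 - g k = 3 * x - 3 by rewrite /g !subr0 invr1 /k invrK; ring.
have -> : (3 / x - k) * (2 * x ^+ 2) = 4 * x by rewrite /k; field; rewrite gt_eqF.
lra.
Qed.

(** With amplitude 1 and t = 1, the boundary terms 1 / a + 1 / b and the increment 1 / a - 1 / b of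
    the majorant add up to 2 / a, which the factor 2 t halves. *)
Lemma fresnel_increment_le H c a b : 0 < a -> a <= b ->
  (forall x, is_derive x 1 H (cos (x ^+ 2 + c))) ->
  `|H b - H a| <= a^-1.
Proof.
move=> a0 ab dH.
have q : 0 \notin `[a, b] by rewrite in_itv/= negb_and -!ltNge a0.
have dH1 x : x \in `]a, b[ ->
    is_derive x 1 H (1 * cos (1 * (x - 0) ^+ 2 + c)).
  by rewrite subr0 !mul1r => _; exact: dH.
have cH : {within `[a, b], continuous H}.
  exact: (is_derive_within_continuous (fun x _ => dH x)).
have dh x : x \in `[a, b] -> is_derive x 1 (fun=> 1 : R) ((fun=> 0 : R) x).
  by move=> _; exact: is_derive_cst.
pose g y := - (y - 0)^-1.
have dg y : y \in `[a, b] -> is_derive y 1 g (y ^- 2).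
  rewrite in_itv/= => /andP[ky _].
  have n0 : y - 0 != 0 by rewrite subr0 gt_eqF// (lt_le_trans a0).
  have := is_derive_subr_inv n0 => ?.
  by apply: is_derive_eq; rewrite /GRing.scale/= subr0; ring.
have cg := is_derive_within_continuous dg.
have dg' y : y \in `]a, b[ -> is_derive y 1 g (y ^- 2).
  by move/subset_itv_oo_cc; exact: dg.
have hg y : y \in `]a, b[ ->
    `|(fun=> 0 : R) y| / `|y - 0| + `|(fun=> 1 : R) y| / `|y - 0| ^+ 2 <= y ^- 2.
  rewrite in_itv/= subr0 => /andP[ay _].
  by rewrite normr0 mul0r add0r normr1 mul1r gtr0_norm// (lt_trans a0).
apply: (le_trans (oscillatory_increment_le ltr01 ab q cH cg dH1 dh dg' hg)).
rewrite normr1 /g !subr0 !gtr0_norm ?(lt_le_trans a0)//.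
lra.
Qed.

Lemma fresnel_le2 H c x : 0 <= x -> H 0 = 0 ->
  (forall x, is_derive x 1 H (cos (x ^+ 2 + c))) -> `|H x| <= 2.
Proof.
move=> x0 H0 dH.
have small y : 0 <= y -> y <= 1 -> `|H y| <= 1.
  move=> y0 y1.
  have cHy : {within `[0, y], continuous H}.
    exact: (is_derive_within_continuous (fun x _ => dH x)).
  have did z : z \in `]0, y[ -> is_derive z 1 (fun z : R => z) ((fun=> 1) z).
    by move=> _; exact: is_derive_id.
  have cid : {within `[0, y], continuous (fun z : R => z)}.
    by apply: continuous_subspaceT => z; exact: cvg_id.
  have hle z : z \in `]0, y[ -> `|cos (z ^+ 2 + c)| <= (fun=> 1) z.
    by move=> _; rewrite ler_norml cos_geN1 cos_le1.
  have := increment_le y0 cHy cid (fun z _ => dH z) did hle.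
  by rewrite H0 !subr0 => /le_trans; exact.
have [x1|/ltW x1] := leP x 1; first by have := small x x0 x1; lra.
have h1 := small 1 ler01 (lexx 1).
have h2 := fresnel_increment_le ltr01 x1 dH.
rewrite -(subrK (H 1) (H x)) (le_trans (ler_normD _ _))//.
by rewrite (le_trans (lerD h2 h1))// invr1.
Qed.

Lemma fresnel_odd H c x : H 0 = 0 ->
  (forall x, is_derive x 1 H (cos (x ^+ 2 + c))) -> H (- x) = - H x.
Proof.
move=> H0 dH; pose D y := H y + H (- y).
have dN (y : R) : is_derive y 1 (fun y : R => - y) (-1).
  by apply: is_derive_eq.
have dD (y : R) : is_derive y 1 D 0.
  have d2 := @is_derive1_comp R H (fun y => - y) y _ _ (dH (- y)) (dN y).
  have d2' : is_derive y 1 (fun y => H (- y)) (cos ((- y) ^+ 2 + c) * -1) by [].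
  by have := dH y => ?; apply: is_derive_eq; rewrite sqrrN; ring.
have := @is_derive_0_is_cst _ D x 0 dD.
rewrite /D oppr0 H0 addr0; lra.
Qed.

End FresnelBounds.

(** * The modulus of the Fresnel integral *)

Section FresnelModulus.
Context {R : realType}.
Implicit Types (a b x : R).

Lemma cos_subpihalf x : cos (x + - (pi / 2)) = sin x.
Proof. by rewrite cosD cosN sinN cos_pihalf sin_pihalf; ring. Qed.

(** Here a and b stand for sqrt t times the distances from q to p1 and p2. By oddness [Cf a + Cf b]
    and [Sf a + Sf b] are integrals over [-a, b], across the stationary point, so the square root is
    the modulus of a complex Fresnel integral. *)
Lemma fresnel_exists : exists Cf Sf : R -> R,
  [/\ (forall x, is_derive x 1 Cf (cos (x ^+ 2))) /\
      (forall x, is_derive x 1 Sf (sin (x ^+ 2))),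
      (forall x, Cf (- x) = - Cf x) /\ (forall x, Sf (- x) = - Sf x) &
      forall a b, 0 < a -> 0 < b ->
        `|Num.sqrt ((Cf a + Cf b) ^+ 2 + (Sf a + Sf b) ^+ 2) - Num.sqrt pi|
          <= 24 * (a^-1 + b^-1)].
Proof.
have prim (c : R) : exists H : R -> R, H 0 = 0 /\
    forall x, is_derive x 1 H (cos (x ^+ 2 + c)).
  have [|H dH] := @continuous_exists_primitive R (fun x => cos (x ^+ 2 + c)).
    move=> x; have d : is_derive x 1 (fun x => cos (x ^+ 2 + c))
        (- (2 * x * sin (x ^+ 2 + c))).
      by apply: is_derive_eq; rewrite /GRing.scale/=; ring.
    exact: is_derive_continuous d.
  exists (fun x => H x - H 0); split; first by rewrite subrr.
  by move=> x; have := dH x => ?; apply: is_derive_eq; rewrite subr0.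
have [Cf [C0 dC0]] := prim 0; have [Sf [S0 dS0]] := prim (- (pi / 2)).
have dC x : is_derive x 1 Cf (cos (x ^+ 2)) by have := dC0 x; rewrite addr0.
have dS x : is_derive x 1 Sf (sin (x ^+ 2)).
  by have := dS0 x; rewrite cos_subpihalf.
exists Cf, Sf; split => //.
  by split => x; [exact: fresnel_odd dC0|exact: fresnel_odd dS0].
move=> a b a0 b0.
set E := a^-1 + b^-1.
have aV : 0 < a^-1 by rewrite invr_gt0.
have bV : 0 < b^-1 by rewrite invr_gt0.
have E0 : 0 < E by rewrite addr_gt0.
(* The phases c = 0, here, and c = pi / 2, in [diff], extract the two components of the squared
   integral. *)
have prod x : 0 < x -> `|2 * (Cf x * Sf x) - pi / 4| <= 3 * x^-1.
  move=> x0; have := fresnel_identity dC dS C0 S0 0 x.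
  rewrite cos0 sin0 !mul1r mul0r addr0 => ->.
  by rewrite addrAC subrr add0r normrN fresnel_phase_integral_le.
have diff x : 0 < x -> `|Cf x ^+ 2 - Sf x ^+ 2| <= 3 * x^-1.
  move=> x0; have := fresnel_identity dC dS C0 S0 (pi / 2) x.
  rewrite cos_pihalf sin_pihalf !mul1r !mul0r add0r sub0r => ->.
  by rewrite normrN fresnel_phase_integral_le.
(* Two bounds on a difference, [E] and 4, make its square at most 4 E: linear in [E], however large
   [E] is. *)
have incr (H : R -> R) c : H 0 = 0 ->
    (forall x, is_derive x 1 H (cos (x ^+ 2 + c))) ->
    `|H a - H b| <= E /\ `|H a - H b| <= 4.
  move=> H0 dH; split.
    have [ab|/ltW ba] := leP a b.
      rewrite distrC (le_trans (fresnel_increment_le a0 ab dH))// /E; lra.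
    rewrite (le_trans (fresnel_increment_le b0 ba dH))// /E; lra.
  have := fresnel_le2 (ltW a0) H0 dH; have := fresnel_le2 (ltW b0) H0 dH.
  by have := ler_normB (H a) (H b); lra.
have [uE u4] := incr Cf 0 C0 dC0; have [vE v4] := incr Sf _ S0 dS0.
have pa := prod a a0; have pb := prod b b0.
have da := diff a a0; have db := diff b b0.
move: uE u4 vE v4 pa pb da db.
set u := Cf a - Cf b; set v := Sf a - Sf b.
set X := Cf a + Cf b; set Y := Sf a + Sf b.
move=> uE u4 vE v4 pa pb da db.
have sq (z : R) : `|z| <= E -> `|z| <= 4 -> z ^+ 2 <= 4 * E.
  move=> zE z4; rewrite -real_normK ?num_real// expr2.
  by rewrite ler_pM.
have u2 := sq u uE u4; have v2 := sq v vE v4.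
have u20 := sqr_ge0 u; have v20 := sqr_ge0 v.
have uv : `|u * v| <= 4 * E by rewrite normrM ler_pM.
(* With Gamma = Cf - i Sf:
   (Gamma(a) + Gamma(b))^2 = 2 Gamma(a)^2 + 2 Gamma(b)^2 - (Gamma(a) - Gamma(b))^2,
   where both squares are close to - i pi/4 and the difference is small. *)
have A : `|X ^+ 2 - Y ^+ 2| <= 10 * E.
  have -> : X ^+ 2 - Y ^+ 2 = 2 * (Cf a ^+ 2 - Sf a ^+ 2) +
      2 * (Cf b ^+ 2 - Sf b ^+ 2) - u ^+ 2 + v ^+ 2 by rewrite /X /Y /u /v; ring.
  move: da db; rewrite !ler_norml /E in u2 v2 *; lra.
have B : `|2 * (X * Y) - pi| <= 14 * E.
  have -> : 2 * (X * Y) - pi = 2 * (2 * (Cf a * Sf a) - pi / 4) +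
      2 * (2 * (Cf b * Sf b) - pi / 4) - 2 * (u * v).
    by rewrite /X /Y /u /v; field.
  move: pa pb uv; rewrite !ler_norml /E; lra.
(* N^2 is the sum of the squares of the two quantities just estimated, so N lies between 2 X Y and
   the sum of their absolute values; 24 is 10 + 14. *)
set N := X ^+ 2 + Y ^+ 2.
have N0 : 0 <= N by rewrite addr_ge0// sqr_ge0.
have NN : N ^+ 2 = (X ^+ 2 - Y ^+ 2) ^+ 2 + (2 * (X * Y)) ^+ 2.
  by rewrite /N; ring.
have Nle : N <= `|X ^+ 2 - Y ^+ 2| + `|2 * (X * Y)|.
  rewrite -ler_sqr ?nnegrE ?N0 ?(addr_ge0 (normr_ge0 _) (normr_ge0 _))//.
  rewrite NN [leRHS]sqrrD !real_normK ?num_real//.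
  by rewrite -addrA lerD2l lerDr mulrn_wge0// mulr_ge0.
have Nge : 2 * (X * Y) <= N.
  rewrite -subr_ge0 (_ : N - _ = (X - Y) ^+ 2) ?sqr_ge0// /N; ring.
have pi1 : 1 <= pi :> R by have := @pi_ge2 R; lra.
have pi0 : 0 <= pi :> R by exact: pi_ge0.
have Npi : `|N - pi| <= 24 * E.
  have B' : `|2 * (X * Y)| <= pi + 14 * E.
    rewrite -(subrK pi (2 * (X * Y))) (le_trans (ler_normD _ _))//.
    by rewrite (ger0_norm pi0); lra.
  have := B; rewrite !ler_norml; lra.
(* Passing from N to its square root divides by sqrt N + sqrt pi, which is at least 1. *)
have spi1 : 1 <= Num.sqrt pi :> R by rewrite -[leLHS]sqrtr1 ler_sqrt// (le_trans _ pi1).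
have sN := sqrtr_ge0 N.
apply: le_trans Npi.
have -> : N - pi = (Num.sqrt N - Num.sqrt pi) * (Num.sqrt N + Num.sqrt pi).
  by rewrite -subr_sqr !sqr_sqrtr.
rewrite normrM -[leLHS]mulr1 ler_wpM2l//.
by rewrite ger0_norm; lra.
Qed.

End FresnelModulus.

(** * Amplitudes with a power singularity and a C^1 factor *)

Section Amplitude.
Context {R : realType}.
Implicit Types (a b p x nu K : R) (g : R -> R).

(** The clamp onto [a, b] is 1-Lipschitz, so it turns continuity within the interval into continuity
    on the line. *)
Lemma clamp_continuous_comp g a b : a <= b ->
  {within `[a, b], continuous g} ->
  continuous (fun x => g (Num.max a (Num.min x b))).
Proof.
move=> ab cg x; set cl := fun x => Num.max a (Num.min x b).
have clE y : [\/ y <= a /\ cl y = a, a <= y <= b /\ cl y = y | b <= y /\ cl y = b].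
  rewrite /cl; have [yb|/ltW by_] := leP y b; last first.
    by apply: Or33; split => //; exact/max_idPr.
  have [ay|/ltW ya] := leP a y; first by apply: Or32.
  by apply: Or31.
have clin y : `[a, b]%classic (cl y).
  by rewrite /= in_itv/=; case: (clE y) => -[? ->]; rewrite ?lexx ?ab.
have cly y : `|cl x - cl y| <= `|x - y|.
  by case: (clE x) => -[? ->]; case: (clE y) => -[? ->]; rewrite ler_norml;
    case: (ler0P (x - y)) => xy; lra.
have /subspace_continuousP/(_ (cl x) (clin x)) cgx := cg.
apply: (@cvg_comp _ _ _ cl g _ _ _ _ cgx).
move=> P [e /= e0 eP]; exists e => //= y xy.
by apply: eP (clin y) => /=; exact: le_lt_trans (cly y) xy.
Qed.

(** [C1_cc] provides derivatives only inside the interval, and [g] is arbitrary outside. Integrating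
    the clamped derivative gives a function equal to [g] on [a, b] with two-sided derivatives at the
    endpoints too. *)
Lemma C1_cc_extension g a b : a < b -> C1_cc a b g ->
  exists v v' : R -> R, exists2 M : R, 0 <= M &
    [/\ forall x, is_derive x 1 v (v' x), forall x, x \in `[a, b] -> v x = g x &
        forall x, x \in `[a, b] -> `|v x| <= M /\ `|v' x| <= M].
Proof.
move=> ab [cg dg [g' cg' g'E]].
pose v' x := g' (Num.max a (Num.min x b)).
have cv' : continuous v' by apply: clamp_continuous_comp => //; exact: ltW.
have v'E x : x \in `[a, b] -> v' x = g' x.
  rewrite in_itv/= /v' => /andP[ax xb].
  by rewrite (min_idPl xb) (max_idPr ax).
have [V dV] := continuous_exists_primitive cv'.
pose v x := V x - V a + g a.
have dv x : is_derive x 1 v (v' x).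
  by have := dV x => ?; apply: is_derive_eq; rewrite subr0 addr0.
have cv : continuous v by move=> x; exact: is_derive_continuous (dv x).
have vE x : x \in `[a, b] -> v x = g x.
  rewrite in_itv/= => /andP[ax xb].
  pose D x := v x - g x.
  have cD : {within `[a, x], continuous D}.
    have cg1 : {within `[a, x], continuous g}.
      by apply: continuous_subspaceW cg; apply: subset_itvl; rewrite bnd_simp.
    have cv1 : {within `[a, x], continuous v} by exact: continuous_subspaceT.
    by move=> y; apply: cvgB; [exact: cv1|exact: cg1].
  have dD y : y \in `]a, x[ -> is_derive y 1 D ((fun=> 0) y).
    move=> yx; have yab : y \in `]a, b[.
      by move: yx; rewrite !in_itv/= => /andP[-> /lt_le_trans->].
    have dgy : is_derive y 1 g (g' y).
      by apply: DeriveDef; [exact: dg|rewrite -derive1E g'E].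
    have := dv y => ?; apply: is_derive_eq.
    by rewrite v'E ?subrr//; exact: subset_itv_oo_cc.
  have [y _] := MVT_segment ax dD cD.
  by rewrite /D /v mul0r => /eqP; rewrite subr_eq0 => /eqP; lra.
have bounded (f : R -> R) : continuous f -> exists2 M, 0 <= M &
    forall x, x \in `[a, b] -> `|f x| <= M.
  move=> cf; have cnf : {within `[a, b], continuous (fun x => `|f x|)}.
    by apply: continuous_subspaceT => x; apply: cvg_norm; exact: cf.
  by have [c _ hc] := EVT_max (ltW ab) cnf; exists `|f c|.
have [M1 M10 h1] := bounded v cv; have [M2 M20 h2] := bounded v' cv'.
exists v, v', (M1 + M2); first exact: addr_ge0.
split => // x xab; split.
  by rewrite (le_trans (h1 x xab))// lerDl.
by rewrite (le_trans (h2 x xab))// lerDr.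
Qed.

Lemma singular_amplitude nu p1 p2 g : 0 < nu < 1 -> p1 < p2 -> C1_cc p1 p2 g ->
  exists f f' : R -> R, exists2 K : R, 0 <= K &
    [/\ forall x, x \in `]p1, p2] -> f x = (x - p1) `^ (nu - 1) * g x,
        forall x, x \in `]p1, p2] -> is_derive x 1 f (f' x),
        forall x, x \in `]p1, p2] -> `|f x| <= K * (x - p1) `^ (nu - 1) &
        forall x, x \in `]p1, p2] -> `|f' x| <= K * (x - p1) `^ (nu - 2)].
Proof.
move=> /andP[nu0 nu1] p12 /(C1_cc_extension p12)[v [v' [M M0 [dv vE vM]]]].
pose f x := (x - p1) `^ (nu - 1) * v x.
pose f' x := (nu - 1) * (x - p1) `^ (nu - 2) * v x + (x - p1) `^ (nu - 1) * v' x.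
have oc x : x \in `]p1, p2] -> x \in `[p1, p2] by exact: subset_itv_oc_cc.
have dp : 0 <= p2 - p1 by rewrite subr_ge0 ltW.
(* The term of f' with v' carries (x - p1)^(nu - 1) = (x - p1) (x - p1)^(nu - 2), and x - p1 <= p2 -
   p1. *)
exists f, f', (M * (1 + (p2 - p1))); first by rewrite mulr_ge0// addr_ge0.
split => x xp.
- by rewrite /f vE ?oc.
- have /andP[p1x _] : p1 < x <= p2 by move: xp; rewrite in_itv.
  have := is_derive_powR_subr (nu - 1) p1x; have := dv x => ?.
  rewrite (_ : nu - 1 - 1 = nu - 2) => [?|]; last by ring.
  by apply: is_derive_eq; rewrite /f' /GRing.scale/=; ring.
- rewrite /f normrM mulrC (ger0_norm (powR_ge0 _ _)) ler_wpM2r ?powR_ge0//.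
  have [h _] := vM x (oc x xp); rewrite (le_trans h)//.
  by rewrite ler_peMr// lerDl.
- have /andP[p1x xp2] : p1 < x <= p2 by move: xp; rewrite in_itv.
  have x0 : 0 < x - p1 by rewrite subr_gt0.
  have [h h'] := vM x (oc x xp).
  rewrite /f' -(mulr_powRB1_gt0 (nu - 1) x0) (_ : nu - 1 - 1 = nu - 2); last by ring.
  have P0 := powR_ge0 (x - p1) (nu - 2).
  rewrite mulrAC -(mulrA (x - p1)) [_ * v' x]mulrC mulrA -mulrDl normrM (ger0_norm P0).
  rewrite ler_wpM2r// (le_trans (ler_normD _ _))// mulrDr mulr1 lerD//.
    rewrite normrM -[leRHS]mul1r ler_pM// ler_norml; lra.
  rewrite normrM mulrC (@ger0_norm _ (x - p1)) ?(ltW x0)// ler_pM// ?(ltW x0)//; lra.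
Qed.

End Amplitude.

(** * Asymptotics of the real oscillatory integrals *)

Section OscillatoryIntegral.
Context {R : realType}.
Notation mu := (@lebesgue_measure R).
Implicit Types (a b c p q r t x nu delta eps K : R) (f g h : R -> R).

Lemma is_derive_fresnel_phase (Cf Sf : R -> R) t c q x : 0 < t ->
  (forall x, is_derive x 1 Cf (cos (x ^+ 2))) ->
  (forall x, is_derive x 1 Sf (sin (x ^+ 2))) ->
  is_derive x 1 (fun x => (Num.sqrt t)^-1 *
      (cos c * Cf (Num.sqrt t * (x - q)) - sin c * Sf (Num.sqrt t * (x - q))))
    (cos (t * (x - q) ^+ 2 + c)).
Proof.
move=> t0 dC dS.
set s := Num.sqrt t; have s0 : s != 0 by rewrite gt_eqF// sqrtr_gt0.
have d1 : is_derive x 1 (fun x => s * (x - q)) s.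
  by apply: is_derive_eq; rewrite /GRing.scale/=; ring.
have dC1 := @is_derive1_comp R Cf (fun x => s * (x - q)) x _ _ (dC (s * (x - q))) d1.
have dS1 := @is_derive1_comp R Sf (fun x => s * (x - q)) x _ _ (dS (s * (x - q))) d1.
have dC2 : is_derive x 1 (fun x => Cf (s * (x - q)))
  (cos ((s * (x - q)) ^+ 2) * s) by [].
have dS2 : is_derive x 1 (fun x => Sf (s * (x - q)))
  (sin ((s * (x - q)) ^+ 2) * s) by [].
apply: is_derive_eq; rewrite /GRing.scale/=.
rewrite cosD -(sqr_sqrtr (ltW t0)) -/s -exprMn; field.
by [].
Qed.

Lemma continuous_cos_phase f t c q x : {for x, continuous f} ->
  {for x, continuous (fun p => f p * cos (t * (p - q) ^+ 2 + c))}.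
Proof.
move=> cf; apply: cvgM; first exact: cf.
exact: is_derive_continuous (is_derive_cos_phase t c q x).
Qed.

Lemma integrable_cos_phase nu K p1 p2 f t c q : 0 < nu -> p1 < p2 ->
  (forall x, x \in `]p1, p2[ -> {for x, continuous f}) ->
  (forall x, x \in `]p1, p2[ -> `|f x| <= K * (x - p1) `^ (nu - 1)) ->
  mu.-integrable `[p1, p2]
    (EFin \o (fun p => f p * cos (t * (p - q) ^+ 2 + c))).
Proof.
move=> nu0 p12 cf fK; apply: (@integrable_powR_bounded R _ p1 p2 nu K) => //.
  by move=> x xp; apply: continuous_cos_phase; exact: cf.
move=> x xp; apply: le_trans (fK x xp); rewrite normrM -[leRHS]mulr1 ler_pM//.
by rewrite ler_norml cos_geN1 cos_le1.
Qed.

(** The oscillation is ignored, which gives a bound uniform in t; it serves for small times. *)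
Lemma oscillatory_integral_bounded nu K p1 p2 f t c q : 0 < nu -> p1 < p2 ->
  0 <= K ->
  (forall x, x \in `]p1, p2[ -> {for x, continuous f}) ->
  (forall x, x \in `]p1, p2[ -> `|f x| <= K * (x - p1) `^ (nu - 1)) ->
  `|Rintegral mu `[p1, p2] (fun p => f p * cos (t * (p - q) ^+ 2 + c))| <=
    K / nu * (p2 - p1) `^ nu.
Proof.
move=> nu0 p12 K0 cf fK.
have [|H [cH dH ->]] := integrable_exists_primitive p12
  (integrable_cos_phase t c q nu0 p12 cf fK).
  by move=> x xp; apply: continuous_cos_phase; exact: cf.
pose g x := K / nu * (x - p1) `^ nu.
have cg : {within `[p1, p2], continuous g}.
  by move=> x; apply: cvgMr; exact: continuous_powR_subr0.
have dg x : x \in `]p1, p2[ -> is_derive x 1 g (K * (x - p1) `^ (nu - 1)).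
  rewrite in_itv/= => /andP[ax _]; have ? := is_derive_powR_subr nu ax.
  by apply: is_derive_eq; rewrite /GRing.scale/=; field; rewrite gt_eqF.
have hg x : x \in `]p1, p2[ ->
    `|f x * cos (t * (x - q) ^+ 2 + c)| <= K * (x - p1) `^ (nu - 1).
  move=> xp; apply: le_trans (fK x xp); rewrite normrM -[leRHS]mulr1 ler_pM//.
  by rewrite ler_norml cos_geN1 cos_le1.
have := increment_le (ltW p12) cH cg dH dg hg.
by rewrite /g subrr powR0 ?gt_eqF// mulr0 subr0.
Qed.

Lemma oscillatory_integral_asymptotics (Cf Sf : R -> R) nu delta eps K p1 p2 f f' :
  (forall x, is_derive x 1 Cf (cos (x ^+ 2))) ->
  (forall x, is_derive x 1 Sf (sin (x ^+ 2))) ->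
  (forall x, Cf (- x) = - Cf x) -> (forall x, Sf (- x) = - Sf x) ->
  0 < nu < 1 -> 0 < delta < 1 -> 0 < eps -> p1 + eps < p2 -> 0 <= K ->
  (forall x, x \in `]p1, p2] -> is_derive x 1 f (f' x)) ->
  (forall x, x \in `]p1, p2] -> `|f x| <= K * (x - p1) `^ (nu - 1)) ->
  (forall x, x \in `]p1, p2] -> `|f' x| <= K * (x - p1) `^ (nu - 2)) ->
  exists2 C : R, 0 <= C & forall t c q s, 1 <= t -> s = Num.sqrt t ->
    q \in `]p1 + eps, p2[ ->
    `|Rintegral mu `[p1, p2] (fun p => f p * cos (t * (p - q) ^+ 2 + c)) -
      f q * (s^-1 * (cos c * (Cf (s * (q - p1)) + Cf (s * (p2 - q))) -
                     sin c * (Sf (s * (q - p1)) + Sf (s * (p2 - q)))))|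
    <= C * (t `^ (- nu) + t `^ (- delta)).
Proof.
move=> dC dS oddC oddS nu01 d01 eps0 p12e K0 df fK f'K.
have [C C0 hC] := singular_phase_le nu01 d01 eps0 p12e K0 df fK f'K.
exists C => // t c q s t1 es qe.
have t0 : 0 < t by exact: lt_le_trans t1.
have p12 : p1 < p2 by lra.
have oo x : x \in `]p1, p2[ -> x \in `]p1, p2] by exact: subset_itv_oo_oc.
have cf x : x \in `]p1, p2[ -> {for x, continuous f}.
  by move=> /oo /df; exact: is_derive_continuous.
have nu0 : 0 < nu by case/andP: nu01.
have [|H [cH dH ->]] := integrable_exists_primitive p12
  (integrable_cos_phase t c q nu0 p12 cf (fun x xp => fK x (oo x xp))).
  by move=> x xp; apply: continuous_cos_phase; exact: cf.
pose G x := s^-1 * (cos c * Cf (s * (x - q)) - sin c * Sf (s * (x - q))).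
have dG x := is_derive_fresnel_phase c q x t0 dC dS.
rewrite -es in dG.
(* [G] is a primitive of the pure phase; subtracting [f q] times it leaves the amplitude f - f q, as
   [singular_phase_le] requires. *)
pose H1 x := H x - f q * G x.
have cH1 : {within `[p1, p2], continuous H1}.
  have cG : {within `[p1, p2], continuous G}.
    exact: (is_derive_within_continuous (fun x _ => dG x)).
  by move=> x; apply: cvgB; [exact: cH|apply: cvgMr; exact: cG].
have dH1 x : x \in `]p1, p2[ ->
    is_derive x 1 H1 ((f x - f q) * cos (t * (x - q) ^+ 2 + c)).
  move=> xp; have := dH x xp; have := dG x => d1 d2.
  have d1' : is_derive x 1 G (cos (t * (x - q) ^+ 2 + c)) by exact: d1.
  by apply: is_derive_eq; rewrite /GRing.scale/=; ring.
have := hC t c q H1 t1 qe cH1 dH1.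
rewrite (_ : H1 p2 - H1 p1 = H p2 - H p1 - f q * (s^-1 *
  (cos c * (Cf (s * (q - p1)) + Cf (s * (p2 - q))) -
   sin c * (Sf (s * (q - p1)) + Sf (s * (p2 - q))))))//.
(* Oddness turns [G p2 - G p1] into a sum over the two sides of q. *)
rewrite /H1 /G (_ : s * (p1 - q) = - (s * (q - p1))); last by ring.
by rewrite oddC oddS; ring.
Qed.

End OscillatoryIntegral.

(** * Properties of the real-valued modulus *)

Section ComplexModulus.
Context {R : realType}.
Implicit Types (a b : R) (z w : R[i]%C).

Lemma cabsE z : cabs z = Num.sqrt (complex.Re z ^+ 2 + complex.Im z ^+ 2).
Proof. by case: z. Qed.

Lemma cabs_ge0 z : 0 <= cabs z.
Proof. by rewrite cabsE sqrtr_ge0. Qed.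

Lemma cabs_le_ReIm z : cabs z <= `|complex.Re z| + `|complex.Im z|.
Proof.
rewrite cabsE -[leRHS]ger0_norm ?addr_ge0// -sqrtr_sqr ler_wsqrtr// sqrrD.
by rewrite !real_normK ?num_real// -addrA lerD2l lerDr mulrn_wge0// mulr_ge0.
Qed.

Lemma ler_dist_cabs z w : `|cabs z - cabs w| <= cabs (z - w).
Proof.
have tri (u v : R[i]%C) : cabs (u + v) <= cabs u + cabs v by exact: le_normcD.
have sym : cabs (w - z) = cabs (z - w).
  by rewrite -opprB; exact: normcN.
have := tri (z - w) w; have := tri (w - z) z.
by rewrite !subrK sym ler_norml; lra.
Qed.

Lemma cabsM z w : cabs (z * w) = cabs z * cabs w.
Proof. exact: ComplexField.Normc.normcM. Qed.

Lemma cabs_real a : cabs (a%:C)%C = `|a|.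
Proof. by rewrite cabsE/= expr0n addr0 sqrtr_sqr. Qed.

End ComplexModulus.

(** * The free solution in terms of cosine integrals *)

Section FreeSolution.
Context {R : realType}.
Notation mu := (@lebesgue_measure R).
Implicit Types (a b c p q t x : R) (f g h : R -> R).

Lemma integrable_add f g (D : interval R) :
  mu.-integrable [set` D] (EFin \o f) -> mu.-integrable [set` D] (EFin \o g) ->
  mu.-integrable [set` D] (EFin \o (fun x => f x + g x)).
Proof.
move=> i1 i2.
have mD : measurable ([set` D] : set (measurableTypeR R)) by exact: measurable_itv.
have := integrableD mD i1 i2.
by apply: eq_integrable => // x _; rewrite /= EFinD.
Qed.

Lemma integrable_sub f g (D : interval R) :
  mu.-integrable [set` D] (EFin \o f) -> mu.-integrable [set` D] (EFin \o g) ->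
  mu.-integrable [set` D] (EFin \o (fun x => f x - g x)).
Proof.
move=> i1 i2.
have mD : measurable ([set` D] : set (measurableTypeR R)) by exact: measurable_itv.
have := integrableB mD i1 i2.
by apply: eq_integrable => // x _; rewrite /= EFinB.
Qed.

Lemma Rintegral_cc_oo g a b : measurable_fun `]a, b[ g ->
  Rintegral mu `[a, b] g = Rintegral mu `]a, b[ g.
Proof.
move=> mg; have mg' : measurable_fun `]a, b] g by exact: measurable_fun_itv_oc mg.
rewrite /Rintegral -integral_itv_obnd_cbnd; last exact/measurable_EFinP.
by rewrite -integral_itv_bndo_bndc//; exact/measurable_EFinP.
Qed.

(** The amplitude formula for [Fu0] holds only in the open interval; the endpoints are negligible,
    and [g] inherits measurability inside from [h]. *)
Lemma eq_Rintegral_oo g h a b : mu.-integrable `[a, b] (EFin \o h) ->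
  (forall x, x \in `]a, b[ -> g x = h x) ->
  Rintegral mu `[a, b] g = Rintegral mu `[a, b] h.
Proof.
move=> ih gh.
have mh : measurable_fun `]a, b[ h.
  have /integrableP[/measurable_EFinP mh _] := ih.
  by apply: measurable_funS mh => //; exact: subset_itv_oo_cc.
have mg : measurable_fun `]a, b[ g.
  by apply: eq_measurable_fun mh => x; rewrite inE => /gh ->.
rewrite !Rintegral_cc_oo//; apply: eq_Rintegral => x; rewrite inE; exact: gh.
Qed.

(** Completing the square: - t p^2 + 2 t q p = - (t (p - q)^2 + c). The shifted phase [c'] produces
    the sines, so [I] covers all four products of real and imaginary parts. *)
Lemma free_solution_phase p1 p2 (Fu0 : R -> R[i]%C) f1 f2 t q :
  (forall c, mu.-integrable `[p1, p2]
    (EFin \o (fun p => f1 p * cos (t * (p - q) ^+ 2 + c)))) ->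
  (forall c, mu.-integrable `[p1, p2]
    (EFin \o (fun p => f2 p * cos (t * (p - q) ^+ 2 + c)))) ->
  (forall p, p \in `]p1, p2[ -> Fu0 p = (f1 p +i* f2 p)%C) ->
  let I f c := Rintegral mu `[p1, p2] (fun p => f p * cos (t * (p - q) ^+ 2 + c)) in
  let c := - (t * q ^+ 2) in let c' := c + pi / 2 in
  free_solution p1 p2 Fu0 t (2 * t * q) =
  (((2 * pi)^-1)%:C * ((I f1 c - I f2 c') +i* (I f1 c' + I f2 c)))%C.
Proof.
move=> i1 i2 Fu I c c'; rewrite /free_solution; congr (_ * _).
have phase p : - (t * p ^+ 2) + 2 * t * q * p = - (t * (p - q) ^+ 2 + c).
  by rewrite /c; ring.
have phase' p : cos (t * (p - q) ^+ 2 + c') = - sin (t * (p - q) ^+ 2 + c).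
  by rewrite /c' addrA cosD cos_pihalf sin_pihalf mulr0 mulr1 sub0r.
rewrite /cintegral /I -RintegralB// -RintegralD//.
congr (_ +i* _)%C.
  apply: eq_Rintegral_oo => [|p pp].
    exact: integrable_sub (i1 c) (i2 c').
  rewrite Fu// /expi phase cosN sinN phase' /=; ring.
apply: eq_Rintegral_oo => [|p pp].
  exact: integrable_add (i1 c') (i2 c).
by rewrite Fu// /expi phase cosN sinN phase' /=; ring.
Qed.

End FreeSolution.

(** * Pointwise asymptotics along the rays x = 2 t q *)

Section PointwiseAsymptotics.
Context {R : realType}.
Notation mu := (@lebesgue_measure R).
Implicit Types (a b c p q t x nu delta eps K : R) (f g h : R -> R).

Definition singular_C1 nu K a b f f' :=
  [/\ forall x, x \in `]a, b] -> is_derive x 1 f (f' x),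
      forall x, x \in `]a, b] -> `|f x| <= K * (x - a) `^ (nu - 1) &
      forall x, x \in `]a, b] -> `|f' x| <= K * (x - a) `^ (nu - 2)].

Lemma singular_C1_le nu K K' a b f f' : K <= K' ->
  singular_C1 nu K a b f f' -> singular_C1 nu K' a b f f'.
Proof.
move=> KK' [df fK f'K]; split => // x xab.
  by rewrite (le_trans (fK x xab))// ler_wpM2r// powR_ge0.
by rewrite (le_trans (f'K x xab))// ler_wpM2r// powR_ge0.
Qed.

Lemma singular_C1_vanishing nu K a b f f' eps : nu < 1 -> 0 <= K -> 0 < eps ->
  singular_C1 nu K a b f f' -> f b = 0 ->
  forall q, q \in `]a + eps, b[ ->
    `|f q| <= K * eps `^ (nu - 2) * (b - q).
Proof.
move=> nu1 K0 eps0 [df _ f'K] fb q qab.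
have sub x : x \in `[a + eps, b] -> x \in `]a, b].
  by rewrite !in_itv/=; lra.
have := qab; rewrite in_itv/= => /andP[aq qb].
have qin : q \in `[a + eps, b] by exact: subset_itv_oo_cc.
have bin : b \in `[a + eps, b] by rewrite in_itv/= lexx andbT; lra.
have f'L x : x \in `[a + eps, b] -> `|f' x| <= K * eps `^ (nu - 2).
  move=> xab; rewrite (le_trans (f'K x (sub x xab)))// ler_wpM2l//.
  by apply: ler_powR_npos => //; move: xab; rewrite in_itv/=; lra.
have := lipschitz_of_derive_le (fun x xab => df x (sub x xab)) f'L qin bin.
by rewrite fb subr0 distrC (@ger0_norm _ (b - q)) ?subr_ge0 ?(ltW qb).
Qed.

Lemma free_solution_asymptotics nu delta eps K p1 p2 (Fu0 : R -> R[i]%C)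
    f1 f1' f2 f2' :
  0 < nu < 1 -> 1 / 2 < delta < 1 -> 0 < eps -> p1 + eps < p2 -> 0 <= K ->
  singular_C1 nu K p1 p2 f1 f1' -> singular_C1 nu K p1 p2 f2 f2' ->
  f1 p2 = 0 -> f2 p2 = 0 ->
  (forall p, p \in `]p1, p2[ -> Fu0 p = (f1 p +i* f2 p)%C) ->
  exists2 C : R, 0 <= C & forall t q, 0 < t -> q \in `]p1 + eps, p2[ ->
    `|cabs (free_solution p1 p2 Fu0 t (2 * t * q)) -
      (2 * pi)^-1 * ((Num.sqrt t)^-1 * Num.sqrt pi * cabs (Fu0 q))|
    <= C * (t `^ (- nu) + t `^ (- delta)).
Proof.
move=> nu01 /andP[dl d1] eps0 p12e K0 A1 A2 f1p2 f2p2 Fu.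
have /andP[nu0 nu1] := nu01.
have d01 : 0 < delta < 1 by apply/andP; split; lra.
have p12 : p1 < p2 by lra.
have [Cf [Sf [[dC dS] [oC oS] fresnel]]] := @fresnel_exists R.
have [df1 f1K f1'K] := A1; have [df2 f2K f2'K] := A2.
have [C1 C10 h1] := oscillatory_integral_asymptotics dC dS oC oS nu01 d01 eps0
  p12e K0 df1 f1K f1'K.
have [C2 C20 h2] := oscillatory_integral_asymptotics dC dS oC oS nu01 d01 eps0
  p12e K0 df2 f2K f2'K.
pose L := K * eps `^ (nu - 2).
have L0 : 0 <= L by rewrite mulr_ge0 ?powR_ge0.
have L2 : 0 <= 2 * L by exact: mulr_ge0.
have L2p : 0 <= 2 * L * (p2 - p1).
  by apply: mulr_ge0 => //; lra.
have L2pe : 0 <= 2 * L * (p2 - p1) / eps by apply: divr_ge0 => //; exact: ltW.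
pose B := K / nu * (p2 - p1) `^ nu.
have B0 : 0 <= B by rewrite !mulr_ge0 ?powR_ge0// invr_ge0 ltW.
have oo x : x \in `]p1, p2[ -> x \in `]p1, p2] by exact: subset_itv_oo_oc.
have cont f f' : singular_C1 nu K p1 p2 f f' -> forall x, x \in `]p1, p2[ ->
    {for x, continuous f} /\ `|f x| <= K * (x - p1) `^ (nu - 1).
  by move=> [df fK _] x /oo xp; split; [exact: is_derive_continuous (df x xp)|exact: fK].
have int f f' t q c : singular_C1 nu K p1 p2 f f' -> mu.-integrable `[p1, p2]
    (EFin \o (fun p => f p * cos (t * (p - q) ^+ 2 + c))).
  move=> /cont cf; apply: (@integrable_cos_phase R nu K) => // x xp.
    by have [] := cf x xp.
  by have [] := cf x xp.
have bnd f f' t q c : singular_C1 nu K p1 p2 f f' ->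
    `|Rintegral mu `[p1, p2] (fun p => f p * cos (t * (p - q) ^+ 2 + c))| <= B.
  move=> /cont cf; apply: oscillatory_integral_bounded => // x xp.
    by have [] := cf x xp.
  by have [] := cf x xp.
have pi0 : 0 < (2 * pi : R)^-1 by rewrite invr_gt0 mulr_gt0// pi_gt0.
have spi0 : 0 <= Num.sqrt pi :> R by exact: sqrtr_ge0.
(* [D1] is for t >= 1: first the error of the four cosine integrals, then that of the Fresnel
   modulus. [D2] is for t < 1: the sizes of the solution and of the main term, without the factor 1
   / (2 pi). *)
pose D1 := 2 * (C1 + C2) + 24 * (2 * L + 2 * L * (p2 - p1) / eps).
pose D2 := 4 * B + Num.sqrt pi * (2 * L * (p2 - p1)).
have D10 : 0 <= D1.
  by rewrite /D1; lra.
have D20 : 0 <= D2.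
  have h : 0 <= Num.sqrt pi * (2 * L * (p2 - p1)) by exact: mulr_ge0.
  by rewrite /D2; lra.
exists ((2 * pi)^-1 * (D1 + D2)); first by rewrite mulr_ge0 ?(ltW pi0)// addr_ge0.
move=> t q t0 qe.
have [q1 q2] : p1 + eps < q /\ q < p2 by apply/andP; move: qe; rewrite in_itv.
have qp : q \in `]p1, p2[ by rewrite in_itv/=; lra.
have V1 := singular_C1_vanishing nu1 K0 eps0 A1 f1p2 qe.
have V2 := singular_C1_vanishing nu1 K0 eps0 A2 f2p2 qe.
rewrite -/L in V1 V2.
have FL : cabs (Fu0 q) <= 2 * L * (p2 - q).
  rewrite Fu// (le_trans (cabs_le_ReIm _))//= (le_trans (lerD V1 V2))//; lra.
have F0 := cabs_ge0 (Fu0 q).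
have FLp : cabs (Fu0 q) <= 2 * L * (p2 - p1).
  by rewrite (le_trans FL)// ler_wpM2l//; lra.
rewrite (free_solution_phase (fun c => int _ _ t q c A1)
  (fun c => int _ _ t q c A2) Fu).
set c := - (t * q ^+ 2); set c' := c + pi / 2.
rewrite cabsM cabs_real (gtr0_norm pi0) -mulrBr normrM (gtr0_norm pi0) -[leRHS]mulrA.
rewrite ler_wpM2l ?(ltW pi0)//.
set I11 := Rintegral _ _ _; set I22 := Rintegral _ _ _.
set I12 := Rintegral _ _ _; set I21 := Rintegral _ _ _.
set W := (_ +i* _)%C.
set s := Num.sqrt t; have s0 : 0 < s by rewrite sqrtr_gt0.
have s2 : s ^+ 2 = t by rewrite sqr_sqrtr// ltW.
have sV0 : 0 < s^-1 by rewrite invr_gt0.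
have n0 := powR_ge0 t (- nu); have dd0 := powR_ge0 t (- delta).
set eta := _ + t `^ (- delta).
have eta0 : 0 <= eta by rewrite addr_ge0.
have [t1|t1] := leP 1 t; last first.
  have W4 : cabs W <= 4 * B.
    rewrite (le_trans (cabs_le_ReIm _))//=.
    have b11 := bnd _ _ t q c A1; have b22 := bnd _ _ t q c' A2.
    have b12 := bnd _ _ t q c' A1; have b21 := bnd _ _ t q c A2.
    have := ler_normB I11 I22; have := ler_normD I12 I21.
    by move: b11 b22 b12 b21; rewrite -/I11 -/I22 -/I12 -/I21; lra.
  have td1 : 1 <= t `^ (- delta).
    by rewrite -[leLHS](congr1 (@^~ (- delta)) (powR1 R)) ler_powR_npos ?(ltW t1)//; lra.
  (* The main term blows up like t^(-1/2) at 0, and t^-delta dominates it. *)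
  have std : s^-1 <= t `^ (- delta).
    rewrite /s -(powR12_sqrt (ltW t0)) -powRN.
    have t01 : 0 < t <= 1 by rewrite t0 ltW.
    by apply: (ger_powR t01); lra.
  have td0 : 0 <= t `^ (- delta) by exact: powR_ge0.
  have m1 : s^-1 * Num.sqrt pi * cabs (Fu0 q) <=
      t `^ (- delta) * (Num.sqrt pi * (2 * L * (p2 - p1))).
    by rewrite -mulrA ler_pM ?mulr_ge0 ?(ltW sV0)// ler_wpM2l.
  have m2 : cabs W <= 4 * B * t `^ (- delta).
    by rewrite (le_trans W4)// ler_peMr// mulr_ge0.
  rewrite (le_trans (ler_normB _ _))// !ger0_norm ?cabs_ge0 ?mulr_ge0 ?(ltW sV0)//.
  apply: (@le_trans _ _ (D2 * t `^ (- delta))); first by rewrite /D2 mulrDl; lra.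
  by rewrite ler_pM ?lerDr// /eta lerDr.
set X := Cf (s * (q - p1)) + Cf (s * (p2 - q)).
set Y := Sf (s * (q - p1)) + Sf (s * (p2 - q)).
pose A x := s^-1 * (cos x * X - sin x * Y).
(* The main term: [Fu0 q] times a Fresnel integral rotated by the phase [c], so that its modulus
   does not depend on [c]. *)
pose Z := ((f1 q +i* f2 q) * (A c +i* A c'))%C.
have WZ : cabs (W - Z) <= 2 * (C1 + C2) * eta.
  rewrite (le_trans (cabs_le_ReIm _))//=.
  have e11 := h1 t c q s t1 erefl qe; have e22 := h2 t c' q s t1 erefl qe.
  have e12 := h1 t c' q s t1 erefl qe; have e21 := h2 t c q s t1 erefl qe.
  rewrite -/X -/Y -/(A _) -/eta -/I11 -/I22 -/I12 -/I21 in e11 e22 e12 e21.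
  have -> : I11 - I22 - (f1 q * A c - f2 q * A c') =
    (I11 - f1 q * A c) - (I22 - f2 q * A c') by ring.
  have -> : I12 + I21 - (f1 q * A c' + f2 q * A c) =
    (I12 - f1 q * A c') + (I21 - f2 q * A c) by ring.
  have := ler_normB (I11 - f1 q * A c) (I22 - f2 q * A c').
  have := ler_normD (I12 - f1 q * A c') (I21 - f2 q * A c).
  by move: e11 e22 e12 e21; lra.
have cZ : cabs Z = s^-1 * Num.sqrt (X ^+ 2 + Y ^+ 2) * cabs (Fu0 q).
  rewrite cabsM -Fu// mulrC; congr (_ * _); rewrite cabsE/=.
  have -> : A c ^+ 2 + A c' ^+ 2 = s^-1 ^+ 2 * (X ^+ 2 + Y ^+ 2).
    have -> : A c' = s^-1 * (- sin c * X - cos c * Y).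
      by rewrite /A /c' cosD sinD cos_pihalf sin_pihalf; ring.
    rewrite /A -[X in _ = _ * X]mul1r -(cos2Dsin2 c); ring.
  by rewrite sqrtrM ?sqr_ge0// sqrtr_sqr (gtr0_norm sV0).
have a0 : 0 < s * (q - p1) by rewrite mulr_gt0//; lra.
have b0 : 0 < s * (p2 - q) by rewrite mulr_gt0//; lra.
have fr := fresnel _ _ a0 b0; rewrite -/X -/Y in fr.
have main : `|cabs Z - s^-1 * Num.sqrt pi * cabs (Fu0 q)| <=
    24 * (2 * L + 2 * L * (p2 - p1) / eps) * t^-1.
  rewrite cZ -mulrBl -mulrBr !normrM (gtr0_norm sV0) (ger0_norm F0).
  apply: (@le_trans _ _ (s^-1 * (24 * ((s * (q - p1))^-1 + (s * (p2 - q))^-1)) *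
    cabs (Fu0 q))); first by rewrite ler_wpM2r// ler_wpM2l ?(ltW sV0).
  (* The two factors 1 / s give 1 / t; [FL] pays for 1 / (p2 - q), and q - p1 > eps for the other
     fraction. *)
  have -> : s^-1 * (24 * ((s * (q - p1))^-1 + (s * (p2 - q))^-1)) * cabs (Fu0 q)
      = 24 * (cabs (Fu0 q) / (p2 - q) + cabs (Fu0 q) / (q - p1)) * t^-1.
    rewrite -s2; field; rewrite !subr_eq0 !gt_eqF//; lra.
  rewrite ler_wpM2r ?invr_ge0 ?(ltW t0)// ler_wpM2l// lerD//.
    by rewrite ler_pdivrMr// subr_gt0.
  rewrite ler_pM ?invr_ge0//; first lra.
  by rewrite lef_pV2 ?posrE//; lra.
have -> : cabs W - s^-1 * Num.sqrt pi * cabs (Fu0 q) = (cabs W - cabs Z) +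
  (cabs Z - s^-1 * Num.sqrt pi * cabs (Fu0 q)) by ring.
rewrite (le_trans (ler_normD _ _))//.
have wz := le_trans (ler_dist_cabs W Z) WZ.
rewrite (le_trans (lerD wz main))//.
have tV : t^-1 <= eta by rewrite (le_trans (inv_le_powR t1 (ltW d1)))// lerDr.
apply: (@le_trans _ _ (D1 * eta)); last by rewrite ler_wpM2r// lerDl.
rewrite /D1 [leRHS]mulrDl lerD2l ler_wpM2l// mulr_ge0//.
lra.
Qed.

End PointwiseAsymptotics.

(** * L^2 norms of continuous functions *)

Section L2Distance.
Context {R : realType}.
Notation mu := (@lebesgue_measure R).
Implicit Types (a b c s t x M N A B : R) (f g h k l : R -> R).

(** Only values inside the interval count, so the modulus of [g] may be replaced by a globally
    continuous [k], whose square has a primitive. *)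
Lemma L2norm_continuous a b (g : R -> R[i]%C) k : continuous k ->
  (forall x, x \in `]a, b[ -> cabs (g x) = k x) ->
  L2norm a b g = (Num.sqrt (Rintegral mu `[a, b] (fun x => k x ^+ 2)))%:E.
Proof.
move=> ck gk; set k2 := fun x => k x ^+ 2.
have ck2 : continuous k2 by move=> x; apply: cvgM; exact: ck.
have ik : mu.-integrable `[a, b] (EFin \o k2).
  by apply: continuous_itv_integrable => x _; exact: ck2.
have mk (D : set R) : measurable_fun D k2.
  by apply: measurable_funTS; exact: continuous_measurable_fun.
rewrite /L2norm unlock.
transitivity ((\int[mu]_(x in `[a, b]) (k2 x)%:E) `^ 2^-1)%E; last first.
  rewrite -[X in (X `^ _)%E]fineK; last by apply: integrable_fin_num => //.
  rewrite poweR_EFin powR12_sqrt//.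
  by apply: Rintegral_ge0 => x _; exact: sqr_ge0.
congr (_ `^ _)%E.
rewrite -integral_itv_obnd_cbnd; last by apply/measurable_EFinP; exact: mk.
rewrite -integral_itv_bndo_bndc; last by apply/measurable_EFinP; exact: mk.
rewrite [RHS]integral_mkcond; apply: eq_integral => x _.
rewrite !patchE; case: ifPn => [|_].
  rewrite inE/= => xab; rewrite /k2 -gk//= ger0_norm ?cabs_ge0//.
  by rewrite -[2%R in LHS]/(2%:R) powR_mulrn ?cabs_ge0.
by rewrite abse0 poweR0r.
Qed.

Lemma Rintegral_sqr_scale k a b s c : 0 < s -> a <= b -> continuous k ->
  Rintegral mu `[s * a, s * b] (fun x => (c * k (x / s)) ^+ 2) =
  c ^+ 2 * s * Rintegral mu `[a, b] (fun x => k x ^+ 2).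
Proof.
move=> s0 ab ck; have sab : s * a <= s * b by rewrite ler_pM2l.
have ck2 : continuous (fun x => k x ^+ 2) by move=> x; apply: cvgM; exact: ck.
have [H dH] := continuous_exists_primitive ck2.
have dsV (x : R) : is_derive x 1 (fun x => x / s) s^-1.
  by apply: is_derive_eq; rewrite /GRing.scale/=; ring.
have csV (x : R) : {for x, continuous (fun x => x / s)}.
  exact: is_derive_continuous (dsV x).
have ckc (x : R) : {for x, continuous (fun x => (c * k (x / s)) ^+ 2)}.
  have h : {for x, continuous (fun x => c * k (x / s))}.
    by apply: cvgMr; apply: (continuous_comp (csV x)); exact: ck.
  by apply: cvgM; exact: h.
rewrite (Rintegral_derive ab (fun x _ => ck2 x) (fun x _ => dH x)).
have dG (x : R) : is_derive x 1 (fun x => c ^+ 2 * s * H (x / s)) ((c * k (x / s)) ^+ 2).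
  have d1 := @is_derive1_comp R H (fun x => x / s) x _ _ (dH (x / s)) (dsV x).
  have d2 : is_derive x 1 (fun x => H (x / s)) (k (x / s) ^+ 2 * s^-1) by [].
  by apply: is_derive_eq; rewrite /GRing.scale/=; field; rewrite gt_eqF.
rewrite (Rintegral_derive sab (fun x _ => ckc x) (fun x _ => dG x)).
by rewrite -mulrBr ![s * _]mulrC !mulfK ?gt_eqF.
Qed.

(** Minkowski's inequality for [l] and the constant [M], whose norm is M sqrt (b - a), in a form
    that needs only a pointwise inequality and primitives. *)
Lemma sqrt_Rintegral_triangle k l M a b : a <= b -> 0 <= M ->
  continuous k -> continuous l ->
  (forall x, x \in `]a, b[ -> 0 <= k x <= l x + M /\ 0 <= l x) ->
  Num.sqrt (Rintegral mu `[a, b] (fun x => k x ^+ 2)) <=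
  Num.sqrt (Rintegral mu `[a, b] (fun x => l x ^+ 2)) + M * Num.sqrt (b - a).
Proof.
move=> ab M0 ck cl kl.
have ck2 : continuous (fun x => k x ^+ 2) by move=> x; apply: cvgM; exact: ck.
have cl2 : continuous (fun x => l x ^+ 2) by move=> x; apply: cvgM; exact: cl.
have [Hk dHk] := continuous_exists_primitive ck2.
have [Hl dHl] := continuous_exists_primitive cl2.
rewrite (Rintegral_derive ab (fun x _ => ck2 x) (fun x _ => dHk x)).
have l0 : 0 <= Rintegral mu `[a, b] (fun x => l x ^+ 2).
  by apply: Rintegral_ge0 => x _; exact: sqr_ge0.
rewrite (Rintegral_derive ab (fun x _ => cl2 x) (fun x _ => dHl x)) in l0 *.
set A := Num.sqrt _; set B := Num.sqrt _; set N := M * _.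
have B0 : 0 <= B by exact: sqrtr_ge0.
have N0 : 0 <= N by rewrite mulr_ge0// sqrtr_ge0.
have B2 : B ^+ 2 = Hl b - Hl a by rewrite sqr_sqrtr.
have N2 : N ^+ 2 = M ^+ 2 * (b - a) by rewrite exprMn sqr_sqrtr// subr_ge0.
(* The slack e / 2 keeps [u] and [v] positive, hence invertible, even if [B] or [N] is 0. With the
   weights v / u and u / v, the integrated bound is at most (u + v)^2. *)
apply/ler_addgt0Pr => e e0.
pose u := B + e / 2; have u0 : 0 < u by rewrite /u; lra.
pose v := N + e / 2; have v0 : 0 < v by rewrite /v; lra.
have uB : B ^+ 2 <= u ^+ 2 by rewrite lerXn2r ?nnegrE// /u; lra.
have vN : N ^+ 2 <= v ^+ 2 by rewrite lerXn2r ?nnegrE// /v; lra.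
(* AM-GM: [2 l M <= (v / u) l^2 + (u / v) M^2] *)
pose G x := (1 + v / u) * Hl x + (1 + u / v) * M ^+ 2 * x.
have dG (x : R) : is_derive x 1 G ((1 + v / u) * l x ^+ 2 + (1 + u / v) * M ^+ 2).
  by have := dHl x => ?; apply: is_derive_eq; rewrite /GRing.scale/=; ring.
have hG x : x \in `]a, b[ ->
    `|k x ^+ 2| <= (1 + v / u) * l x ^+ 2 + (1 + u / v) * M ^+ 2.
  move=> /kl [/andP[k0 klM] lx0]; rewrite ger0_norm ?sqr_ge0//.
  apply: (@le_trans _ _ ((l x + M) ^+ 2)).
    by rewrite lerXn2r ?nnegrE ?addr_ge0.
  rewrite -subr_ge0.
  have -> : (1 + v / u) * l x ^+ 2 + (1 + u / v) * M ^+ 2 - (l x + M) ^+ 2 =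
      (v * l x - u * M) ^+ 2 / (u * v) by field; rewrite !gt_eqF.
  by rewrite divr_ge0 ?sqr_ge0// mulr_ge0// ltW.
have inc := increment_le ab (is_derive_within_continuous (fun x _ => dHk x))
  (is_derive_within_continuous (fun x _ => dG x)) (fun x _ => dHk x)
  (fun x _ => dG x) hG.
have Auv : Hk b - Hk a <= (u + v) ^+ 2.
  rewrite (le_trans (ler_norm _))// (le_trans inc)//.
  have -> : G b - G a = (1 + v / u) * B ^+ 2 + (1 + u / v) * N ^+ 2.
    by rewrite B2 N2 /G; ring.
  have -> : (u + v) ^+ 2 = (1 + v / u) * u ^+ 2 + (1 + u / v) * v ^+ 2.
    by field; rewrite !gt_eqF.
  by rewrite lerD// ler_wpM2l// addr_ge0// divr_ge0// ltW.
have -> : B + N + e = u + v by rewrite /u /v; field.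
have uv0 : 0 <= u + v by rewrite addr_ge0// ltW.
rewrite /A -[leRHS](ger0_norm uv0) -sqrtr_sqr.
by rewrite ler_wsqrtr.
Qed.

Lemma sqrt_Rintegral_dist k l M a b : a <= b -> 0 <= M ->
  continuous k -> continuous l ->
  (forall x, x \in `]a, b[ -> 0 <= k x /\ 0 <= l x) ->
  (forall x, x \in `]a, b[ -> `|k x - l x| <= M) ->
  `|Num.sqrt (Rintegral mu `[a, b] (fun x => k x ^+ 2)) -
    Num.sqrt (Rintegral mu `[a, b] (fun x => l x ^+ 2))| <= M * Num.sqrt (b - a).
Proof.
move=> ab M0 ck cl k0 klM.
have := @sqrt_Rintegral_triangle k l M a b ab M0 ck cl.
have := @sqrt_Rintegral_triangle l k M a b ab M0 cl ck.
move=> h1 h2; rewrite ler_norml; apply/andP; split.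
  suff : forall x, x \in `]a, b[ -> 0 <= l x <= k x + M /\ 0 <= k x by move/h1; lra.
  by move=> x xab; have := k0 x xab; have := klM x xab; rewrite ler_norml; lra.
suff : forall x, x \in `]a, b[ -> 0 <= k x <= l x + M /\ 0 <= l x by move/h2; lra.
by move=> x xab; have := k0 x xab; have := klM x xab; rewrite ler_norml; lra.
Qed.

End L2Distance.

(** * Continuity of the solution in the space variable *)

Section FreeSolutionContinuity.
Context {R : realType}.
Notation mu := (@lebesgue_measure R).
Implicit Types (t x nu K : R) (f g : R -> R).

Lemma integrable_oscillatory nu K p1 p2 f f' t c x : 0 < nu -> p1 < p2 ->
  singular_C1 nu K p1 p2 f f' ->
  mu.-integrable `[p1, p2] (EFin \o (fun p => f p * cos (x * p - t * p ^+ 2 + c))).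
Proof.
move=> nu0 p12 [df fK _].
have oo p : p \in `]p1, p2[ -> p \in `]p1, p2] by exact: subset_itv_oo_oc.
apply: (@integrable_powR_bounded _ _ p1 p2 nu K) => // p /oo pp.
  have dfp := df p pp.
  have ? : is_derive p 1 (fun p => cos (x * p - t * p ^+ 2 + c))
      (- ((x - 2 * t * p) * sin (x * p - t * p ^+ 2 + c))).
    by apply: is_derive_eq; rewrite /GRing.scale/=; ring.
  have d : is_derive p 1 (fun p => f p * cos (x * p - t * p ^+ 2 + c))
      (f p * - ((x - 2 * t * p) * sin (x * p - t * p ^+ 2 + c))
      + f' p * cos (x * p - t * p ^+ 2 + c)).
    by apply: is_derive_eq; rewrite /GRing.scale/=; ring.
  exact: is_derive_continuous d.
apply: le_trans (fK p pp); rewrite normrM -[leRHS]mulr1 ler_pM//.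
by rewrite ler_norml cos_geN1 cos_le1.
Qed.

(** Dominated convergence, the singular power of p - p1 being an integrable majorant independent of
    x. The continuity lets [L2norm_continuous] apply to the solution. *)
Lemma continuous_oscillatory_integral nu K p1 p2 f f' t c : 0 < nu -> p1 < p2 ->
  singular_C1 nu K p1 p2 f f' ->
  continuous (fun x => Rintegral mu `[p1, p2]
    (fun p => f p * cos (x * p - t * p ^+ 2 + c))).
Proof.
move=> nu0 p12 A x; have [_ fK _] := A.
have oo p : p \in `]p1, p2[ -> p \in `]p1, p2] by exact: subset_itv_oo_oc.
pose F y p := f p * cos (y * p - t * p ^+ 2 + c).
pose G p := K * (p - p1) `^ (nu - 1).
have FG y p : p \in `]p1, p2[ -> `|F y p| <= G p.
  move=> /oo /fK; apply: le_trans; rewrite normrM -[leRHS]mulr1 ler_pM//.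
  by rewrite ler_norml cos_geN1 cos_le1.
have sub : (`]p1, p2[%classic : set R) `<=` `[p1, p2] by exact: subset_itv_oo_cc.
have iS h : mu.-integrable `[p1, p2] (EFin \o h) -> mu.-integrable `]p1, p2[ (EFin \o h).
  by apply: integrableS.
have iF y : mu.-integrable `]p1, p2[ (EFin \o F y).
  by apply: iS; exact: integrable_oscillatory A.
have iG : mu.-integrable `]p1, p2[ (EFin \o G).
  apply: iS; apply: (@integrable_powR_bounded R G p1 p2 nu `|K|) => // p.
    rewrite in_itv/= => /andP[pp _].
    by apply: cvgMr; exact: continuous_powR_subr.
  by rewrite normrM (ger0_norm (powR_ge0 _ _)).
have mI : measurable (`]p1, p2[%classic : set (measurableTypeR R)).
  exact: measurable_itv.
have cF : {ae mu, forall p, `]p1, p2[%classic p ->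
    {in `]x - 1, x + 1[%classic, continuous (F ^~ p)}}.
  apply: aeW => p _ y _.
  have d : is_derive y 1 (F ^~ p) (f p * - (p * sin (y * p - t * p ^+ 2 + c))).
    by apply: is_derive_eq; rewrite /GRing.scale/=; ring.
  exact: is_derive_continuous d.
have bF y : `]x - 1, x + 1[%classic y ->
    {ae mu, forall p, `]p1, p2[%classic p -> `|F y p| <= G p}.
  by move=> _; apply: aeW => p; exact: FG.
rewrite (_ : (fun y => _) = fun y => Rintegral mu `]p1, p2[ (F y)); last first.
  apply/funext => y; apply: Rintegral_cc_oo.
  by have /integrableP[/measurable_EFinP] := iF y.
have := continuity_under_integral mI (fun y _ => iF y) cF iG bF.
by move=> /(_ x); apply; rewrite inE/= in_itv/=; lra.
Qed.

Lemma continuous_cabs_free_solution nu K p1 p2 (Fu0 : R -> R[i]%C)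
    f1 f1' f2 f2' t :
  0 < nu -> p1 < p2 ->
  singular_C1 nu K p1 p2 f1 f1' -> singular_C1 nu K p1 p2 f2 f2' ->
  (forall p, p \in `]p1, p2[ -> Fu0 p = (f1 p +i* f2 p)%C) ->
  continuous (fun x => cabs (free_solution p1 p2 Fu0 t x)).
Proof.
move=> nu0 p12 A1 A2 Fu.
pose J f c x := Rintegral mu `[p1, p2] (fun p => f p * cos (x * p - t * p ^+ 2 + c)).
(* [J1] and [J2] are the real and imaginary parts of the solution, up to the factor 1 / (2 pi). *)
pose J1 x := J f1 0 x + J f2 (pi / 2) x.
pose J2 x := J f2 0 x - J f1 (pi / 2) x.
have cJ1 : continuous J1.
  move=> x; apply: cvgD; first exact: continuous_oscillatory_integral A1 x.
  exact: continuous_oscillatory_integral A2 x.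
have cJ2 : continuous J2.
  move=> x; apply: cvgB; first exact: continuous_oscillatory_integral A2 x.
  exact: continuous_oscillatory_integral A1 x.
have iJ f f' c x : singular_C1 nu K p1 p2 f f' ->
    mu.-integrable `[p1, p2] (EFin \o (fun p => f p * cos (x * p - t * p ^+ 2 + c))).
  exact: integrable_oscillatory.
have phase x p : - (t * p ^+ 2) + x * p = x * p - t * p ^+ 2 + 0 by ring.
have phase' x p : cos (x * p - t * p ^+ 2 + pi / 2) = - sin (x * p - t * p ^+ 2 + 0).
  by rewrite addr0 cosD cos_pihalf sin_pihalf mulr0 mulr1 sub0r.
have E x : cabs (free_solution p1 p2 Fu0 t x) =
    (2 * pi)^-1 * Num.sqrt (J1 x ^+ 2 + J2 x ^+ 2).
  rewrite /free_solution cabsM cabs_real gtr0_norm ?invr_gt0 ?mulr_gt0 ?pi_gt0//.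
  congr (_ * _); rewrite cabsE /cintegral /=.
  congr (Num.sqrt (_ ^+ 2 + _ ^+ 2)).
    rewrite /J1 /J -RintegralD//; last 2 first.
    - exact: iJ A1.
    - exact: iJ A2.
    apply: eq_Rintegral_oo => [|p pp].
      by apply: integrable_add; [exact: iJ A1|exact: iJ A2].
    by rewrite Fu// /expi phase phase' /=; ring.
  rewrite /J2 /J -RintegralB//; last 2 first.
  - exact: iJ A2.
  - exact: iJ A1.
  apply: eq_Rintegral_oo => [|p pp].
    by apply: integrable_sub; [exact: iJ A2|exact: iJ A1].
  by rewrite Fu// /expi phase phase' /=; ring.
rewrite (_ : (fun x => _) =
  fun x => (2 * pi)^-1 * Num.sqrt (J1 x ^+ 2 + J2 x ^+ 2)); last first.
  by apply/funext.
move=> x; apply: cvgMr; apply: (@continuous_comp _ _ _ (fun x => J1 x ^+ 2 + J2 x ^+ 2)).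
  by apply: cvgD; apply: cvgM; [exact: cJ1|exact: cJ1|exact: cJ2|exact: cJ2].
exact: sqrt_continuous.
Qed.

End FreeSolutionContinuity.

(** * The L^2 estimate on the moving interval *)

Section FreeSolutionL2.
Context {R : realType}.
Notation mu := (@lebesgue_measure R).

Lemma free_solution_L2norm (nu delta eps K p1 p2 : R) (Fu0 : R -> R[i]%C)
    (f1 f1' f2 f2' : R -> R) :
  0 < nu < 1 -> 1 / 2 < delta < 1 -> 0 < eps -> p1 + eps < p2 -> 0 <= K ->
  singular_C1 nu K p1 p2 f1 f1' -> singular_C1 nu K p1 p2 f2 f2' ->
  f1 p2 = 0 -> f2 p2 = 0 ->
  (forall p, p \in `]p1, p2[ -> Fu0 p = (f1 p +i* f2 p)%C) ->
  exists2 C : R, 0 <= C & forall t : R, 0 < t ->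
    (`|L2norm (2 * (p1 + eps) * t)%R (2 * p2 * t)%R (free_solution p1 p2 Fu0 t) -
       ((Num.sqrt (2 * pi))^-1)%:E * L2norm (p1 + eps)%R p2 Fu0| <=
     (C * (t `^ (- nu + 1 / 2) + t `^ (- delta + 1 / 2)))%:E)%E.
Proof.
move=> nu01 d01 eps0 p12e K0 A1 A2 f1p2 f2p2 Fu.
have [C C0 hC] := free_solution_asymptotics nu01 d01 eps0 p12e K0 A1 A2 f1p2 f2p2 Fu.
have /andP[nu0 _] := nu01.
have p12 : p1 < p2 by lra.
set a := p1 + eps in p12e hC *.
(* On [a, p2], away from the singularity, [f1] and [f2] are continuous; clamping gives |Fu0| a
   continuous version on the whole line. *)
pose cl x := Num.max a (Num.min x p2).
have clE x : x \in `]a, p2[ -> cl x = x.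
  rewrite in_itv/= /cl => /andP[ax xp].
  by rewrite (min_idPl (ltW xp)) (max_idPr (ltW ax)).
have ccl f f' : singular_C1 nu K p1 p2 f f' -> continuous (fun x => f (cl x)).
  move=> [df _ _]; apply: clamp_continuous_comp; first exact: ltW.
  have sub x : x \in `[a, p2] -> is_derive x 1 f (f' x).
    by rewrite in_itv/= => xa; apply: df; rewrite in_itv/=; move: xa; rewrite /a; lra.
  exact: is_derive_within_continuous sub.
pose kF x := Num.sqrt (f1 (cl x) ^+ 2 + f2 (cl x) ^+ 2).
have ckF : continuous kF.
  move=> x; apply: (@continuous_comp _ _ _ (fun x => f1 (cl x) ^+ 2 + f2 (cl x) ^+ 2)).
    apply: cvgD; apply: cvgM; try exact: (ccl _ _ A1 x); exact: (ccl _ _ A2 x).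
  exact: sqrt_continuous.
have kFE x : x \in `]a, p2[ -> cabs (Fu0 x) = kF x.
  move=> xa; rewrite /kF clE// Fu ?cabsE//.
  by move: xa; rewrite !in_itv/= /a; lra.
exists (C * Num.sqrt (2 * (p2 - a))); first by rewrite mulr_ge0 ?sqrtr_ge0.
move=> t t0; have t20 : 0 < 2 * t by rewrite mulr_gt0.
have -> : 2 * a * t = 2 * t * a by ring.
have -> : 2 * p2 * t = 2 * t * p2 by ring.
have cu := @continuous_cabs_free_solution R nu K p1 p2 Fu0 f1 f1' f2 f2' t
  nu0 p12 A1 A2 Fu.
rewrite (L2norm_continuous cu)// (L2norm_continuous ckF kFE).
rewrite -EFinM -EFinB abse_EFin lee_fin.
(* The coefficient of |Fu0 q| in the pointwise asymptotics. As c^2 * 2 t = 1 / (2 pi), the scaling x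
   = 2 t q makes the norm of the main term independent of t. *)
pose c := (2 * pi)^-1 * ((Num.sqrt t)^-1 * Num.sqrt pi) : R.
have pi0 : 0 < (pi : R) by exact: pi_gt0.
have c0 : 0 <= c by rewrite !mulr_ge0 ?invr_ge0 ?sqrtr_ge0// mulr_ge0// ltW.
have scale := Rintegral_sqr_scale c t20 (ltW p12e) ckF.
have -> : (Num.sqrt (2 * pi))^-1 *
    Num.sqrt (Rintegral mu `[a, p2] (fun x => kF x ^+ 2)) =
    Num.sqrt (Rintegral mu `[2 * t * a, 2 * t * p2]
      (fun x => (c * kF (x / (2 * t))) ^+ 2)).
  rewrite scale -sqrtrV ?mulr_ge0 ?(ltW pi0)// -sqrtrM ?invr_ge0 ?mulr_ge0 ?(ltW pi0)//.
  congr (Num.sqrt (_ * _)).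
  have -> : c ^+ 2 * (2 * t) =
      (2 * pi)^-1 ^+ 2 * ((Num.sqrt t ^+ 2)^-1 * Num.sqrt pi ^+ 2) * (2 * t).
    have st0 : 0 < Num.sqrt t by rewrite sqrtr_gt0.
    rewrite /c; move: (pi : R) pi0 => P P0; field.
    by rewrite (gt_eqF st0) (gt_eqF P0).
  rewrite !sqr_sqrtr ?ltW//; move: (pi : R) pi0 => P P0; field.
  by rewrite (gt_eqF t0) (gt_eqF P0).
have cl0 : continuous (fun x : R => c * kF (x / (2 * t))).
  move=> x; apply: cvgMr; apply: (@continuous_comp R _ _ (fun x : R => x / (2 * t))).
    by apply: cvgMl; exact: cvg_id.
  exact: ckF.
have le2 : 2 * t * a <= 2 * t * p2 by rewrite ler_pM2l// ltW.
have eta0 : 0 <= C * (t `^ (- nu) + t `^ (- delta)).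
  by rewrite mulr_ge0// addr_ge0 ?powR_ge0.
apply: le_trans (sqrt_Rintegral_dist le2 eta0 cu cl0 _ _) _.
- by move=> x _; split; [exact: cabs_ge0|rewrite mulr_ge0 ?sqrtr_ge0].
- move=> x xab; pose q := x / (2 * t).
  have xq : x = 2 * t * q by rewrite /q mulrCA mulfV ?gt_eqF ?mulr1.
  have qa : q \in `]a, p2[.
    by move: xab; rewrite xq !in_itv/= !ltr_pM2l.
  rewrite -/q -kFE// xq.
  by have := hC t q t0 qa; rewrite /c !mulrA.
(* The pointwise error is uniform in x, and the length 2 (p2 - a) t supplies the factor t^(1/2). *)
rewrite -mulrBr (_ : 2 * t * (p2 - a) = 2 * (p2 - a) * t); last by ring.
rewrite sqrtrM; last by rewrite mulr_ge0// subr_ge0 ltW.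
rewrite -(powR12_sqrt (ltW t0)) (_ : 1 / 2 = 2^-1 :> R); last by field.
rewrite !(@powRD _ t) ?(gt_eqF t0) ?implybT//.
by rewrite le_eqVlt; apply/predU1P; left; ring.
Qed.

End FreeSolutionL2.

Unset Implicit Arguments.

Theorem theorem0p4 (R : realType) (mu p1 p2 : R)
    (u0 : (R -> complex R) -> complex R) (Fu0 : R -> complex R)
    (eps delta : R) :
  1 / 2 < mu < 1 ->
  p1 < p2 ->
  is_tempered u0 ->
  condition_C p1 p2 mu u0 Fu0 ->
  0 < eps ->
  p1 + eps < p2 ->
  1 / 2 < delta < 1 ->
  \big[Num.max / - sigma mu delta ord0]_(k < 9) (- sigma mu delta k)
    < - (1 / 2) /\
  exists C : 'I_9 -> R,
    (forall k, 0 <= C k) /\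
    forall t : R, 0 < t ->
      (`| L2norm (2 * (p1 + eps) * t)%R (2 * p2 * t)%R
            (free_solution p1 p2 Fu0 t)
          - ((Num.sqrt (2 * pi))^-1)%:E * L2norm (p1 + eps)%R p2 Fu0 |
       <= (\sum_(k < 9) C k * t `^ (- sigma mu delta k + 1 / 2))%:E)%E.
Proof.
move=> mu12 p12 _ [_ _ [util [[cRe cIm] _ utilp2 Fu]]] eps0 p12e d12.
have [/andP[mul mu1] /andP[dl d1]] := (mu12, d12).
split.
  by rewrite !big_ord_recl big_ord0 /sigma /= !gt_max; do ?(apply/andP; split); lra.
have mu01 : 0 < mu < 1 by rewrite mu1 andbT; lra.
have [f1 [f1' [K1 K10 [f1E df1 f1K f1'K]]]] := singular_amplitude mu01 p12 cRe.
have [f2 [f2' [K2 K20 [f2E df2 f2K f2'K]]]] := singular_amplitude mu01 p12 cIm.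
have A1 : singular_C1 mu (K1 + K2) p1 p2 f1 f1'.
  by apply: (@singular_C1_le _ mu K1); [rewrite lerDl|split].
have A2 : singular_C1 mu (K1 + K2) p1 p2 f2 f2'.
  by apply: (@singular_C1_le _ mu K2); [rewrite lerDr|split].
have p2in : p2 \in `]p1, p2] by rewrite in_itv/= p12 lexx.
(* At p2 the power of p - p1 is finite, so the amplitude vanishes with [util]. *)
have f1p2 : f1 p2 = 0 by rewrite f1E// utilp2 mulr0.
have f2p2 : f2 p2 = 0 by rewrite f2E// utilp2 mulr0.
have FuE p : p \in `]p1, p2[ -> Fu0 p = (f1 p +i* f2 p)%C.
  move=> pp; have pp' : p \in `]p1, p2] by exact: subset_itv_oo_oc.
  rewrite Fu// f1E// f2E//; case: (util p) => x y /=.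
  by congr (_ +i* _)%C; ring.
have [C C0 hC] := free_solution_L2norm mu01 d12 eps0 p12e (addr_ge0 K10 K20)
  A1 A2 f1p2 f2p2 FuE.
(* Indices are shifted by one: 0 and 4 stand for sigma_1 and sigma_5. *)
exists (fun k => if (val k == 0%N) || (val k == 4%N) then C else 0); split.
  by move=> k; case: ifP.
move=> t t0; apply: le_trans (hC t t0) _; rewrite lee_fin.
rewrite !big_ord_recl big_ord0 /sigma /= !mul0r !addr0 !add0r mulrDr.
by rewrite lexx.
Qed.
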